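(* Let $(G,\sigma)$ be a cubic signed graph such that $G$ is $3$-edge-colorable. If $(G,\sigma)$ is flow-admissible, then $(G,\sigma)$ admits a nowhere-zero $10$-flow.
   Context: Graphs are finite and may have multiple edges or loops. A signed graph $(G,\sigma)$ is a graph $G$ with a signature $\sigma:E(G)\to\{+1,-1\}$. A graph is cubic if every vertex has degree $3$ (a loop contributes $2$ to the degree), and $3$-edge-colorable if it has a proper edge-coloring with three colors. Each edge $e=uv$ is regarded as two half edges $h_e^u$ (incident with $u$) and $h_e^v$ (incident with $v$); a loop at $v$ gives two half edges both incident with $v$. $H(v)$ is the set of half edges incident with $v$, $H(G)$ is the set of all half edges, and $e_h$ denotes the edge containing the half edge $h$. An orientation of $(G,\sigma)$ is a mapping $\tau:H(G)\to\{+1,-1\}$ such that $\tau(h_e^u)\tau(h_e^v)=-\sigma(e)$ for every edge $e=uv$. For an integer $k\ge 2$, a $k$-flow of $(G,\sigma)$ is a pair $(\tau,f)$ where $\tau$ is an orientation and $f:E(G)\to\mathbb{Z}$ satisfies $|f(e)|\le k-1$ for every edge $e$ and $\sum_{h\in H(v)}\tau(h)f(e_h)=0$ for every vertex $v$. It is nowhere-zero if $f(e)\neq 0$ for every $e\in E(G)$. A signed graph is flow-admissible if it admits a nowhere-zero $k$-flow for some integer $k$. *)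

(* Defs.v *)
From HB Require Import structures.
From mathcomp Require Import all_boot all_order all_algebra.

Set Implicit Arguments.
Unset Strict Implicit.
Unset Printing Implicit Defensive.

Import Order.TTheory GRing.Theory Num.Theory.
Local Open Scope ring_scope.

(* The edge e joins [endpoint e false] to [endpoint e true]; the order of the
   two ends only serves to name the half edges.  Parallel edges and loops are
   allowed. *)
Record multigraph := Multigraph {
  vertex : finType;
  edge : finType;
  endpoint : edge -> bool -> vertex
}.

Section SignedGraphs.

Variable G : multigraph.

(* (e, b) is the half of e at [endpoint e b]: a loop has two half edges. *)
Definition half_edge : Type := (edge G * bool)%type.

Definition edge_of (h : half_edge) : edge G := h.1.

Definition half_edges_at (v : vertex G) : {set edge G * bool} :=
  [set h : edge G * bool | endpoint h.1 h.2 == v].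

Definition degree (v : vertex G) : nat := #|half_edges_at v|.

Definition cubic : Prop := forall v : vertex G, degree v = 3%N.

(* Two distinct half edges at a vertex never have the same colour.  A loop is
   thus adjacent to itself, so a graph with a loop has no proper
   edge-colouring. *)
Definition proper_edge_coloring (n : nat) (c : edge G -> 'I_n) : Prop :=
  forall (v : vertex G) (h h' : half_edge),
    h \in half_edges_at v -> h' \in half_edges_at v -> h <> h' ->
    c (edge_of h) <> c (edge_of h').

Definition edge_colorable (n : nat) : Prop :=
  exists c : edge G -> 'I_n, proper_edge_coloring c.

Definition signature (sigma : edge G -> int) : Prop :=
  forall e, sigma e = 1 \/ sigma e = -1.

Definition orientation (sigma : edge G -> int) (tau : half_edge -> int) : Prop :=
  (forall h, tau h = 1 \/ tau h = -1) /\
  (forall e, tau (e, false) * tau (e, true) = - sigma e).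

Definition is_flow (sigma : edge G -> int) (k : nat)
    (tau : half_edge -> int) (f : edge G -> int) : Prop :=
  [/\ orientation sigma tau,
      forall e, `|f e| <= k%:Z - 1 &
      forall v, \sum_(h in half_edges_at v) tau h * f (edge_of h) = 0].

Definition nowhere_zero (f : edge G -> int) : Prop := forall e, f e <> 0.

Definition has_nowhere_zero_flow (sigma : edge G -> int) (k : nat) : Prop :=
  exists (tau : half_edge -> int) (f : edge G -> int),
    is_flow sigma k tau f /\ nowhere_zero f.

Definition flow_admissible (sigma : edge G -> int) : Prop :=
  exists k : nat, (2 <= k)%N /\ has_nowhere_zero_flow sigma k.

End SignedGraphs.

(* Main.v *)
(* Fix an orientation and work in one connected component.  An integer flow can
   be changed modulo 2 into one with values in [-2, 2]; hence every even subset
   with an even number of negative edges is the set of odd edges of such a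
   flow.  If two even subsets of this kind cover the component, with flows g1
   and g2, then g1 + 3 g2 is a nowhere-zero 9-flow.
     Two colours i, j occur on numbers of negative edges of the same parity, so
   their union A is such an even subset.  A second one, covering the third
   colour k, exists unless A is balanced, hence after switching all positive,
   and the colour class M of k contains an odd number of negative edges.
   Contract the circuits of A: M becomes an Eulerian signed graph with an odd
   number of negative edges, and since the graph is flow-admissible no switching
   leaves exactly one of them.  Splitting off and Menger's theorem then give two
   disjoint odd even subsets, and an extremal choice gives an odd circuit C such
   that all components of M - C have an even number of negative edges while one
   of them is unbalanced.  So there are a flow g with values in [-2, 2], odd on
   M - C and zero on C, and a barbell flow w that is +-1 on C.  At each
   contracted vertex the values of w have total at most 4, so w extends to the
   circuits of A with values in [-1, 1].  Finally g + 2 w + 5 f is a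
   nowhere-zero 10-flow, where f is a flow that is +-1 on A and 0 elsewhere. *)

Require Import Defs.
From mathcomp Require Import all_boot all_order all_algebra.
From mathcomp Require Import zify ring.

Set Implicit Arguments.
Unset Strict Implicit.
Unset Printing Implicit Defensive.

Import Order.TTheory GRing.Theory Num.Theory.
Local Open Scope ring_scope.

(** * Chains, boundaries and integer flows *)

Definition sgb (b : bool) : int := if b then -1 else 1.

(* [bool] is the field with two elements: its sums are sums modulo 2. *)
Definition par (m : int) : bool := m%:~R.

Lemma par_spec m : exists q : int, m = 2 * q + (par m : nat)%:Z.
Proof.
exists (m %/ 2)%Z; rewrite {1}(divz_eq m 2) mulrC; congr (_ + _).
rewrite /par {2}(divz_eq m 2) rmorphD rmorphM /= mulr0 add0r.
have : (0 <= m %% 2 < 2)%Z by lia.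
by case: (m %% 2)%Z => [[|[|k]]|k] //=; lia.
Qed.

Lemma par_small m : `|m| <= 1 -> par m = (m != 0).
Proof. by move=> h; have [q hq] := par_spec m; case: (par m) hq => /= hq; lia. Qed.

Section Chains.
Variables (V E : finType) (ep : E -> bool -> V).

Section Boundary.
Variables (R : comNzRingType) (tau : E -> bool -> R).
Implicit Types (z : E -> R) (v : V).

Definition inc e v : R :=
  (if ep e false == v then tau e false else 0) + (if ep e true == v then tau e true else 0).

(** Over the integers this is the net flow at a vertex; over [bool] it is a degree modulo 2. *)
Definition bd z v : R := \sum_e z e * inc e v.

Lemma eq_bd z1 z2 v : z1 =1 z2 -> bd z1 v = bd z2 v.
Proof. by move=> h; apply: eq_bigr => e _; rewrite h. Qed.

Lemma bdD z1 z2 v : bd (fun e => z1 e + z2 e) v = bd z1 v + bd z2 v.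
Proof. by rewrite /bd -big_split; apply: eq_bigr => e _; rewrite mulrDl. Qed.

Lemma bdZ c z v : bd (fun e => c * z e) v = c * bd z v.
Proof. by rewrite /bd mulr_sumr; apply: eq_bigr => e _; rewrite mulrA. Qed.

Lemma bd0 v : bd (fun=> 0) v = 0.
Proof. by rewrite /bd big1 // => e _; rewrite mul0r. Qed.

Lemma bd_delta e0 c v : bd (fun e => if e == e0 then c else 0) v = c * inc e0 v.
Proof.
rewrite /bd (bigD1 e0) //= eqxx big1 ?addr0 // => e /negbTE ->; exact: mul0r.
Qed.

Lemma bd_bigsum (I : finType) (Z : I -> E -> R) v :
  bd (fun e => \sum_i Z i e) v = \sum_i bd (Z i) v.
Proof.
by rewrite /bd exchange_big; apply: eq_bigr => e _; rewrite mulr_suml.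
Qed.

(** Summation by parts: indicators as [s] give cut identities, vectors of signs give switchings. *)
Lemma bd_dual (s : V -> R) z :
  \sum_v s v * bd z v =
  \sum_e z e * (s (ep e false) * tau e false + s (ep e true) * tau e true).
Proof.
have pick u (t : R) : \sum_v s v * (if u == v then t else 0) = s u * t.
  rewrite (bigD1 u) //= eqxx big1 ?addr0 // => v.
  by rewrite eq_sym => /negbTE ->; rewrite mulr0.
under eq_bigr => v _ do rewrite /bd mulr_sumr.
rewrite exchange_big; apply: eq_bigr => e _.
rewrite -!pick -big_split mulr_sumr; apply: eq_bigr => v _ /=.
by rewrite /inc; ring.
Qed.

Lemma bd_halves z v :
  bd z v = \sum_(h : E * bool | ep h.1 h.2 == v) tau h.1 h.2 * z h.1.
Proof.
rewrite big_mkcond.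
rewrite -(pair_bigA _ (fun e b => if ep e b == v then tau e b * z e else 0)) /=.
apply: eq_bigr => e _; rewrite big_bool /inc mulrDr addrC.
by congr (_ + _); case: eqP; rewrite ?mulr0 // mulrC.
Qed.

End Boundary.

(** Signs become 1 modulo 2, so [bd2 C] vanishes everywhere exactly when [C] is an even subset. *)
Definition bd2 (C : E -> bool) : V -> bool := bd (fun _ _ => 1) C.

Lemma par_bd (tau : E -> bool -> int) (z : E -> int) v :
  (forall e b, tau e b = 1 \/ tau e b = -1) ->
  par (bd tau z v) = bd2 (fun e => par (z e)) v.
Proof.
move=> tauP; rewrite /par /bd2 /bd rmorph_sum /=.
apply: eq_bigr => e _; rewrite intrM; congr (_ * _); rewrite /inc intrD.
by congr (_ + _); case: eqP => // _; [have [] := tauP e false | have [] := tauP e true] => ->.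
Qed.

Lemma bd2_cut C (X : V -> bool) :
  \sum_v X v * bd2 C v = \sum_e C e * (X (ep e false) + X (ep e true)).
Proof.
rewrite bd_dual; apply: eq_bigr => e _; congr (_ * _).
by rewrite !mulr1.
Qed.

(** A loop counts twice. Bounding this total at a contracted vertex keeps the lift to its circuits
    small. *)
Definition load (z : E -> int) v : int :=
  \sum_e `|z e| * ((ep e false == v)%:R + (ep e true == v)%:R).

End Chains.

Lemma inc_half (V E : finType) (ep : E -> bool -> V) (R : comNzRingType)
    (tau : E -> bool -> R) e b v :
  inc ep tau e v = tau e b * (v == ep e b)%:R + tau e (~~ b) * (v == ep e (~~ b))%:R.
Proof.
rewrite /inc ![v == _]eq_sym.
by case: b => /=; case: (ep e false == v); case: (ep e true == v) => /=; ring.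
Qed.

Lemma norm_le_sum (I : finType) (r : I -> int) i : `|r i| <= \sum_j `|r j|.
Proof. by rewrite (bigD1 i) //= lerDl; apply: sumr_ge0. Qed.

Section IntegerFlows.
Variables (V E : finType) (ep : E -> bool -> V) (tau : E -> bool -> int).
Hypothesis tauP : forall e b, tau e b = 1 \/ tau e b = -1.
Local Notation bd := (bd ep tau).
Local Notation inc := (inc ep tau).

Definition conformal (q r : E -> int) :=
  forall e, (0 <= q e /\ q e <= r e) \/ (r e <= q e /\ q e <= 0).

Lemma tau_sq e b : tau e b * tau e b = 1.
Proof. by case: (tauP e b) => ->. Qed.

(** Unit steps agreeing in sign with [r] are peeled off along a walk from [u], until the boundary of
    [r] at the current vertex, corrected for the start, has the sign [t] of the arrival. Each step
    lowers the total absolute value of [r]. *)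
Lemma conformal_trail (r : E -> int) u (s : int) :
  s = 1 \/ s = -1 -> 0 < s * bd r u ->
  exists q w t, [/\ conformal q r, t = 1 \/ t = -1,
    forall v, bd q v = s * (v == u)%:R + t * (v == w)%:R &
    0 < t * (bd r w - s * (w == u)%:R)].
Proof.
have [n le_n] : exists n : nat, \sum_e `|r e| <= n%:Z.
  exists (absz (\sum_e `|r e|)); rewrite gez0_abs //; exact: sumr_ge0.
elim: n r u s le_n => [|n IHn] r u s le_n sP hs.
  have r0 e : r e = 0.
    by have := norm_le_sum r e; lia.
  by move: hs; rewrite (eq_bd _ _ _ r0) bd0 mulr0.
have [e he] : exists e, 0 < s * (r e * inc e u).
  apply/existsP; apply: contraLR hs; rewrite negb_exists => /forallP h.
  rewrite -leNgt mulr_sumr; apply: sumr_le0 => e _; by rewrite leNgt h.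
have [b [eb hb]] : exists b, ep e b = u /\ 0 < s * r e * tau e b.
  move: he; rewrite /inc; case: eqP => [h0|_]; case: eqP => [h1|_].
  - case: (ltP 0 (s * r e * tau e false)) => h; first by exists false.
    by move=> h2; exists true; split=> //; lia.
  - by move=> h2; exists false; split=> //; lia.
  - by move=> h2; exists true; split=> //; lia.
  - by rewrite addr0 !mulr0.
set w := ep e (~~ b); set k := s * tau e b; set s' := k * tau e (~~ b).
have kP : k = 1 \/ k = -1 by rewrite /k; case: sP (tauP e b) => -> [] ->; auto.
have s'P : s' = 1 \/ s' = -1.
  by rewrite /s'; case: kP (tauP e (~~ b)) => -> [] ->; auto.
have kr : 0 < k * r e by move: hb; rewrite /k; lia.
pose d := fun f => if f == e then k else 0.
have bd_d v : bd d v = s * (v == u)%:R + s' * (v == w)%:R.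
  rewrite bd_delta (inc_half _ _ _ b) eb mulrDr !mulrA; congr (_ * _ + _).
  by rewrite /k -mulrA tau_sq mulr1.
have confd : conformal d r.
  move=> f; rewrite /d; case: eqP => [->|_]; last by lia.
  by case: kP kr => ->; lia.
case: (ltP 0 (s' * (bd r w - s * (w == u)%:R))) => [hw|hw].
  by exists d, w, s'.
(* The walk cannot stop at [w], so what is left of [r] has a boundary of sign [- s'] there and a
   further step can leave [w]. *)
pose r' := fun f => r f + -1 * d f.
have bd_r' v : bd r' v = bd r v - s * (v == u)%:R - s' * (v == w)%:R.
  by rewrite bdD bdZ bd_d; ring.
have le' : \sum_f `|r' f| <= n%:Z.
  have : \sum_f `|r' f| + 1 <= \sum_f `|r f|.
    rewrite (bigD1 e) //= [leRHS](bigD1 e) //= addrAC lerD //.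
      by rewrite /r' /d eqxx; case: kP kr => ->; lia.
    apply: ler_sum => f /negbTE fe.
    by rewrite /r' /d fe mulr0 addr0.
  by lia.
have [||q [x [t [confq tP bd_q ht]]]] := IHn r' w (- s') le'.
- by case: s'P => ->; auto.
- by rewrite bd_r' eqxx; case: s'P hw => ->; lia.
exists (fun f => q f + d f), x, t; split=> //.
- move=> f; move: (confq f); rewrite /r' /d; case: eqP => [->|_]; last by lia.
  by case: kP kr => ->; lia.
- by move=> v; rewrite bdD bd_q bd_d; ring.
- by move: ht; rewrite bd_r' mulNr opprK subrK.
Qed.

(* If [`|g0 e| >= 3], trails back from e after removing three units on e give a
   conformal flow x with [0 < `|x e| < `|g0 e|], and [g0 - 2 x] is smaller than g0. *)
Lemma reduce_mod2 (g0 : E -> int) :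
  (forall v, bd g0 v = 0) ->
  exists g : E -> int, [/\ forall v, bd g v = 0, forall e, `|g e| <= 2,
    forall e, par (g e) = par (g0 e) & forall e, g0 e = 0 -> g e = 0].
Proof.
have [n le_n] : exists n : nat, \sum_e `|g0 e| <= n%:Z.
  exists (absz (\sum_e `|g0 e|)); rewrite gez0_abs //; exact: sumr_ge0.
elim: n g0 le_n => [|n IHn] g0 le_n flow0.
  exists g0; split=> // e.
  by have := norm_le_sum g0 e; lia.
case: (boolP [forall e, `|g0 e| <= 2]) => [/forallP h|]; first by exists g0.
rewrite negb_forall => /existsP [e he].
have [x [confx x_e flowx]] : exists x : E -> int,
    [/\ conformal x g0, x e != 0 /\ x e != g0 e & forall v, bd x v = 0].
  pose k : int := if 0 < g0 e then 1 else -1.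
  have kE : (0 < g0 e /\ k = 1) \/ (g0 e <= 0 /\ k = -1).
    by rewrite /k; case: ltP; auto.
  have kP : k = 1 \/ k = -1 by lia.
  clearbody k; pose d := fun f => if f == e then k else 0.
  set u := ep e false; set v := ep e true.
  pose s0 := - (k * tau e false); pose s1 := - (k * tau e true).
  have s0P : s0 = 1 \/ s0 = -1.
    by rewrite /s0; case: kP (tauP e false) => -> [] ->; auto.
  have s1P : s1 = 1 \/ s1 = -1.
    by rewrite /s1; case: kP (tauP e true) => -> [] ->; auto.
  have bd_d x : bd d x = - s0 * (x == u)%:R - s1 * (x == v)%:R.
    by rewrite bd_delta (inc_half _ _ _ false) /s0 /s1; ring.
  (* [d] is one unit on [e] in the direction of [g0]. A chain conformal to [r] has at most
     [|g0 e| - 3] units on [e], so adding [d] leaves between 1 and [|g0 e| - 2]. *)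
  pose r := fun f => g0 f + -3 * d f.
  have bd_r x : bd r x = 3 * (s0 * (x == u)%:R + s1 * (x == v)%:R).
    by rewrite bdD bdZ flow0 bd_d; ring.
  have finish q : conformal q r ->
      (forall x, bd q x = s0 * (x == u)%:R + s1 * (x == v)%:R) ->
      exists x : E -> int,
        [/\ conformal x g0, x e != 0 /\ x e != g0 e & forall v, bd x v = 0].
    move=> confq bd_q; exists (fun f => q f + d f); split.
    - by move=> f; move: (confq f); rewrite /r /d; case: eqP => [->|_]; lia.
    - by have := confq e; rewrite /r /d eqxx; lia.
    - by move=> x; rewrite bdD bd_q bd_d; ring.
  have hr : 0 < s0 * bd r u \/ s1 = - s0 /\ u = v.
    rewrite bd_r eqxx; case: eqP => [uv|]; case: s0P => ->; case: s1P => ->; auto.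
  (* Here [e] is a loop whose halves cancel, so one unit on it is already a flow. *)
  case: hr => [hr|[s10 uv]]; last first.
    apply: (finish (fun=> 0)) => [f|x]; last by rewrite bd0 s10 uv; ring.
    by rewrite /r /d; case: eqP => [->|_]; lia.
  have [q [w [t [confq tP bd_q ht]]]] := conformal_trail s0P hr.
  move: ht; rewrite bd_r; case: (eqVneq w v) => [wv ht|wv].
    have ts1 : t = s1.
      by move: ht; rewrite wv; case: (v == u); case: tP s0P s1P => -> [] -> [] -> /=; lia.
    by apply: (finish q) => // x; rewrite bd_q ts1 wv.
  case: (eqVneq w u) => [wu ht|wu]; last by case: tP => ->; lia.
  have ts0 : t = s0 by move: ht; case: tP s0P => -> [] -> /=; lia.
  have uv : (u == v) = false by rewrite -wu; apply/negbTE.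
  (* The first trail came back to [u] and used two of the three units there. One is left, so a
     second trail from [u] can only end at [v]. *)
  pose r2 := fun f => r f + -1 * q f.
  have bd_r2 x : bd r2 x = s0 * (x == u)%:R + 3 * s1 * (x == v)%:R.
    by rewrite bdD bdZ bd_r bd_q ts0 wu; ring.
  have hr2 : 0 < s0 * bd r2 u by rewrite bd_r2 eqxx uv; case: s0P => ->; lia.
  have [q2 [w2 [t2 [confq2 t2P bd_q2 ht2]]]] := conformal_trail s0P hr2.
  apply: (finish q2).
    by move=> f; move: (confq2 f) (confq f); rewrite /r2; lia.
  move: ht2; rewrite bd_r2; case: (eqVneq w2 v) => [w2v ht2|]; last first.
    by case: (w2 == u); case: t2P => -> /=; rewrite ?mulr0; lia.
  have -> : s1 = t2; last by move=> x; rewrite bd_q2 w2v.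
  move: ht2; rewrite w2v eq_sym uv; case: t2P s1P => -> [] -> /=; lia.
have [||g [gflow g2 gpar gsupp]] := IHn (fun f => g0 f + -2 * x f).
- have : \sum_f `|g0 f + -2 * x f| + 1 <= \sum_f `|g0 f|.
    rewrite (bigD1 e) //= [leRHS](bigD1 e) //= addrAC lerD //.
      by have := confx e; lia.
    apply: ler_sum => f _.
    by have := confx f; lia.
  by lia.
- by move=> v; rewrite bdD bdZ flow0 flowx mulr0 addr0.
exists g; split=> // f.
- rewrite gpar /par rmorphD rmorphM /=.
  by rewrite (_ : (-2)%:~R = 0 :> bool) ?mul0r ?addr0.
- by move=> g0f; apply: gsupp; have := confx f; lia.
Qed.

End IntegerFlows.

(** * The double cover *)

(* N is the set of negative edges: a vertex (v, s) of the double cover stands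
   for v reached with the sign s. *)
Section DoubleCover.
Variables (V E : finType) (ep : E -> bool -> V).
Implicit Types (N F : E -> bool) (p q : V * bool).

Definition adj F : rel V := fun u w =>
  [exists e, exists b, [&& F e, ep e b == u & ep e (~~ b) == w]].

Definition cover_adj N F : rel (V * bool) := fun p q =>
  [exists e, exists b,
    [&& F e, ep e b == p.1, ep e (~~ b) == q.1 & q.2 == p.2 (+) N e]].

(** This says that [F] has a closed walk through [v] with an odd number of negative edges,
    repetitions counted. *)
Definition unbalanced_at N F v := connect (cover_adj N F) (v, false) (v, true).

Lemma adjP F u w :
  reflect (exists e b, [/\ F e, ep e b = u & ep e (~~ b) = w]) (adj F u w).
Proof.
apply: (iffP existsP) => [[e /existsP [b /and3P [Fe /eqP <- /eqP <-]]]|].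
  by exists e, b.
by move=> [e [b [Fe <- <-]]]; exists e; apply/existsP; exists b; rewrite Fe !eqxx.
Qed.

Lemma cover_adjP N F p q :
  reflect (exists e b, [/\ F e, ep e b = p.1, ep e (~~ b) = q.1 & q.2 = p.2 (+) N e])
    (cover_adj N F p q).
Proof.
apply: (iffP existsP) => [[e /existsP [b /and4P [Fe /eqP <- /eqP <- /eqP h]]]|].
  by exists e, b.
move=> [e [b [Fe h1 h2 h3]]]; exists e; apply/existsP; exists b.
by rewrite Fe h1 h2 h3 !eqxx.
Qed.

Lemma adj_edge F e b : F e -> adj F (ep e b) (ep e (~~ b)).
Proof. by move=> Fe; apply/adjP; exists e, b. Qed.

Lemma adj_sym F : connect_sym (adj F).
Proof.
apply: sym_connect_sym => u w.
by apply/adjP/adjP => -[e [b [Fe h1 h2]]]; exists e, (~~ b); rewrite negbK.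
Qed.

Lemma cover_adj_sym N F : connect_sym (cover_adj N F).
Proof.
apply: sym_connect_sym => p q; apply/cover_adjP/cover_adjP.
  move=> [e [b [Fe h1 h2 ->]]]; exists e, (~~ b); rewrite negbK addbK; split=> //.
move=> [e [b [Fe h1 h2 ->]]]; exists e, (~~ b); rewrite negbK addbK; split=> //.
Qed.

Lemma connect_map (T1 T2 : finType) (r1 : rel T1) (r2 : rel T2) (f : T1 -> T2) :
  (forall x y, r1 x y -> connect r2 (f x) (f y)) ->
  forall x y, connect r1 x y -> connect r2 (f x) (f y).
Proof.
move=> h x y /connectP [s]; elim: s x => [|z s IH] x /=; first by move=> _ ->.
by move=> /andP [xz zs] yl; apply: connect_trans (h _ _ xz) (IH _ zs yl).
Qed.

Lemma cover_connect_flip N F p q :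
  connect (cover_adj N F) p q ->
  connect (cover_adj N F) (p.1, ~~ p.2) (q.1, ~~ q.2).
Proof.
apply: (connect_map (f := fun x : V * bool => (x.1, ~~ x.2))) => x y.
move=> /cover_adjP [e [b [Fe h1 h2 h3]]]; apply/connect1/cover_adjP.
by exists e, b; rewrite /= h3 addNb.
Qed.

Lemma cover_connect_proj N F p q :
  connect (cover_adj N F) p q -> connect (adj F) p.1 q.1.
Proof.
apply: (connect_map (f := fst)) => x y /cover_adjP [e [b [Fe <- <- _]]].
exact/connect1/adj_edge.
Qed.

Lemma connect_lift N F u w s :
  connect (adj F) u w -> exists t, connect (cover_adj N F) (u, s) (w, t).
Proof.
move=> /connectP [l]; elim: l u s => [|x l IH] u s /=.
  by move=> _ ->; exists s; exact: connect0.
move=> /andP [/adjP [e [b [Fe h1 h2]]] xl] wl.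
have [t ht] := IH x (s (+) N e) xl wl; exists t; apply: connect_trans ht.
by apply/connect1/cover_adjP; exists e, b.
Qed.

Lemma unbalanced_connect N F u w :
  connect (adj F) u w -> unbalanced_at N F u -> unbalanced_at N F w.
Proof.
move=> uw hu; have [t ht] := connect_lift N false uw.
have ht' := cover_connect_flip ht; rewrite /= in ht'.
have h : connect (cover_adj N F) (w, t) (w, ~~ t).
  apply: connect_trans ht'; apply: connect_trans hu.
  by rewrite cover_adj_sym.
by rewrite /unbalanced_at; case: t h {ht ht'} => //= h; rewrite cover_adj_sym.
Qed.

(* Off the unbalanced components the two lifts of a vertex lie in different
   components of the double cover; comparing the ranks of these two components
   switches the signature to the all-positive one. *)
Lemma potential N F : exists X : V -> bool,
  forall e, F e -> ~~ unbalanced_at N F (ep e false) ->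
    N e = X (ep e false) + X (ep e true).
Proof.
pose rk v s : nat := enum_rank (fingraph.root (cover_adj N F) (v, s)).
exists (fun v => (rk v false < rk v true)%N) => e Fe nbal.
have cnv s : connect (cover_adj N F) (ep e false, s) (ep e true, s (+) N e).
  by apply/connect1/cover_adjP; exists e, false.
have rkE s : rk (ep e true) (s (+) N e) = rk (ep e false) s.
  rewrite /rk; congr (val (enum_rank _)); apply/eqP.
  by rewrite eq_sym root_connect ?cnv //; exact: cover_adj_sym.
have neq : rk (ep e false) false != rk (ep e false) true.
  apply: contra nbal => /eqP /ord_inj /enum_rank_inj /eqP.
  by rewrite root_connect //; exact: cover_adj_sym.
have := rkE false; have := rkE true.
case: (N e) => /= h1 h2; rewrite h1 h2; first by case: ltngtP neq.
by case: (_ < _)%N.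
Qed.

Lemma connect_component F F' r w :
  (forall e, F e -> connect (adj F) r (ep e false) -> F' e) ->
  connect (adj F) r w -> connect (adj F') r w.
Proof.
move=> h /connectP [l pl ->].
have: connect (adj F) r r by exact: connect0.
elim: l {-2}r pl => [|y l IH] x //= /andP [xy yl] rx.
have ry := connect_trans rx (connect1 xy).
apply: connect_trans (IH y yl ry); apply/connect1.
move: xy => /adjP [e [b [Fe h1 h2]]]; apply/adjP; exists e, b; split=> //.
by apply: h => //; case: b h1 h2 => /= h1 h2; rewrite ?h1 ?h2.
Qed.

Lemma cover_connect_component N F F' r s q :
  (forall e, F e -> connect (adj F) r (ep e false) -> F' e) ->
  connect (cover_adj N F) (r, s) q -> connect (cover_adj N F') (r, s) q.
Proof.
move=> h /connectP [l pl ->].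
have: connect (adj F) r (r, s).1 by exact: connect0.
elim: l (r, s) pl => [|y l IH] x //= /andP [xy yl] rx.
have ry : connect (adj F) r y.1.
  by apply: connect_trans rx _; apply: cover_connect_proj (connect1 xy).
apply: connect_trans (IH y yl ry); apply/connect1.
move: xy => /cover_adjP [e [b [Fe h1 h2 h3]]]; apply/cover_adjP; exists e, b; split=> //.
by apply: h => //; case: b h1 h2 => /= h1 h2; rewrite ?h1 ?h2.
Qed.

End DoubleCover.

Section CoverChains.
Variables (V E : finType) (ep : E -> bool -> V) (tau : E -> bool -> int).
Variable N : E -> bool.
Hypothesis tauP : forall e b, tau e b = 1 \/ tau e b = -1.
Hypothesis tauN : forall e b, tau e b * tau e (~~ b) = - sgb (N e).
Local Notation bd := (bd ep tau).
Local Notation load := (load ep).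

Lemma loadD (z1 z2 : E -> int) v : load (fun e => z1 e + z2 e) v <= load z1 v + load z2 v.
Proof.
rewrite /load -big_split; apply: ler_sum => e _ /=; rewrite -mulrDl.
by apply: ler_wpM2r; [lia | exact: ler_normD].
Qed.

Lemma load_delta e0 b (c : int) v : c = 1 \/ c = -1 ->
  load (fun e => if e == e0 then c else 0) v =
  (ep e0 b == v)%:R + (ep e0 (~~ b) == v)%:R.
Proof.
move=> cP; rewrite /load (bigD1 e0) //= eqxx big1 => [|e /negbTE ->]; last by rewrite mul0r.
rewrite addr0 (_ : `|c| = 1); last by lia.
by rewrite mul1r; case: b; rewrite // addrC.
Qed.

(** One unit is pushed along the path, its sign being read off from the sheet, so that contributions
    cancel at inner vertices. A path between the two lifts of a vertex thus has boundary 2 or -2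
    there. *)
Lemma cover_path_chain (F : E -> bool) p (l : seq (V * bool)) :
  path (cover_adj ep N F) p l ->
  exists z : E -> int, [/\ forall e, ~~ F e -> z e = 0,
    forall v, bd z v = sgb (last p l).2 * (v == (last p l).1)%:R - sgb p.2 * (v == p.1)%:R,
    forall v, load z v <= (count (fun q => q.1 == v) (belast p l))%:Z
                          + (count (fun q => q.1 == v) l)%:Z &
    \sum_e par (z e) * N e = (last p l).2 + p.2].
Proof.
elim: l p => [|q l IH] p /=.
  move=> _; exists (fun=> 0); split=> // [v|v|].
  - by rewrite bd0 subrr.
  - by rewrite /load big1 // => e _; rewrite normr0 mul0r.
  - by rewrite big1 => [|e _]; [case: (p.2) | rewrite mul0r].
move=> /andP [/cover_adjP [e [b [Fe h1 h2 h3]]] ql].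
have [z [suppz bdz loadz parz]] := IH q ql.
pose c := - sgb p.2 * tau e b.
have cP : c = 1 \/ c = -1.
  by rewrite /c /sgb; case: (p.2); case: (tauP e b) => ->; auto.
pose d := fun f => if f == e then c else 0.
exists (fun f => d f + z f); split.
- move=> f nFf; rewrite suppz // addr0 /d; case: eqP => // fe.
  by rewrite fe Fe in nFf.
- move=> v; rewrite bdD bdz bd_delta (inc_half _ _ _ b) h1 h2 mulrDr !mulrA.
  have -> : c * tau e b = - sgb p.2 by rewrite /c -mulrA tau_sq // mulr1.
  have -> : c * tau e (~~ b) = sgb q.2; last by ring.
  by rewrite /c -mulrA tauN h3 /sgb; case: (p.2); case: (N e).
- move=> v; apply: le_trans (loadD _ _ _) _.
  rewrite (load_delta _ b) // h1 h2 !natz !PoszD addrACA lerD2l; exact: loadz.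
- rewrite (_ : (last q l).2 + p.2 = N e + ((last q l).2 + q.2)); last first.
    by rewrite h3; case: ((last q l).2); case: (p.2); case: (N e).
  rewrite -parz (bigD1 e) //= [in RHS](bigD1 e) //= addrA; congr (_ + _).
    rewrite /d eqxx /par rmorphD mulrDl /= (_ : c%:~R = 1) ?mul1r //.
    by case: cP => ->.
  by apply: eq_bigr => f /negbTE fe; rewrite /d fe add0r.
Qed.

Lemma count_fiber_le2 (l : seq (V * bool)) v : uniq l ->
  (count (fun q => q.1 == v) l <= 2)%N.
Proof.
move=> ul; rewrite -size_filter.
apply: (@uniq_leq_size _ _ [:: (v, true); (v, false)]); first exact: filter_uniq.
by move=> [x b]; rewrite mem_filter /= => /andP [/eqP -> _]; case: b; rewrite !inE eqxx ?orbT.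
Qed.

Lemma count_fiber_le1 (l : seq (V * bool)) v : uniq l ->
  ~~ (((v, false) \in l) && ((v, true) \in l)) ->
  (count (fun q => q.1 == v) l <= 1)%N.
Proof.
move=> ul h; rewrite -size_filter.
have [b hb] : exists b, (v, b) \notin l.
  by move: h; rewrite negb_and => /orP [] ?; [exists false | exists true].
apply: (@uniq_leq_size _ _ [:: (v, ~~ b)]); first exact: filter_uniq.
move=> [x c]; rewrite mem_filter /= => /andP [/eqP -> hc]; rewrite inE.
by case: (c =P b) hc hb => [-> -> //|]; case: c; case: b.
Qed.

(* z comes from a shortest path in the double cover between the two lifts of a
   vertex of B: such a path meets the lifts of every other vertex of B at most once. *)
Lemma lollipop (F : E -> bool) (B : V -> bool) v0 :
  B v0 -> unbalanced_at ep N F v0 ->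
  exists v1 (z : E -> int), B v1 /\ [/\ forall e, ~~ F e -> z e = 0,
    forall v, bd z v = 2 * (v == v1)%:R,
    forall v, load z v <= 4,
    forall v, B v -> load z v <= 2 &
    \sum_e par (z e) * N e = 1].
Proof.
move=> Bv0 /connectP [l pl ll].
have {ll} ll : last (v0, false) l = (v0, ~~ false) by [].
have [n le_n] : exists n, (size l <= n)%N by exists (size l).
elim: n v0 false l Bv0 pl ll le_n => [|n IH] u s l Bu pl ll le_n.
  by move: le_n ll; case: l {pl} => // _ [] /=; case: s.
case/shortenP: pl ll => l' pl' ul' sub_l' ll.
have {}le_n : (size l' <= n.+1)%N.
  by apply: leq_trans le_n; apply: uniq_leq_size sub_l'; case/andP: ul'.
(* If the path meets both lifts of another vertex of [B], the stretch between them is strictly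
   shorter and replaces it. *)
case: (boolP [exists v, [&& B v, v != u, (v, false) \in l' & (v, true) \in l']]).
  move=> /existsP [v /and4P [Bv vu hf ht]].
  have [t [a [b [c El']]]] : exists t a b c, l' = a ++ (v, t) :: b ++ (v, ~~ t) :: c.
    clear pl' ul' sub_l' ll le_n.
    move: ht; case/splitPr: hf => a b; rewrite mem_cat inE => /or3P [|/eqP //|].
      by case/splitPr => a1 a2; exists true, a1, a2, b; rewrite -catA.
    by case/splitPr => b1 b2; exists false, a, b1, b2.
  apply: (IH v t (rcons b (v, ~~ t))) => //.
  - move: pl'; rewrite El' cat_path /= cat_path /= rcons_path.
    by case/and5P => _ _ -> -> _.
  - by rewrite last_rcons.
  - by move: le_n; rewrite El' size_cat /= size_cat /= size_rcons; lia.
rewrite negb_exists => /forallP nB.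
have [z [suppz bdz loadz parz]] := cover_path_chain pl'.
have lastE : (u, s) :: l' = rcons (belast (u, s) l') (u, ~~ s) by rewrite lastI ll.
pose cnt v := count (fun q : V * bool => q.1 == v).
(* The load counts visits once without the last vertex and once without the first. Both lie over
   [u], so the load at [u] is at most 2. *)
have cntE v : cnt v ((u, s) :: l') = ((u == v) + cnt v l')%N by [].
have cntE' v : cnt v ((u, s) :: l') = (cnt v (belast (u, s) l') + (u == v))%N.
  by rewrite lastE /cnt -cats1 count_cat /= addn0.
have cnt2 v : (cnt v ((u, s) :: l') <= 2)%N by exact: count_fiber_le2.
have load_le v : load z v <= (cnt v (belast (u, s) l') + cnt v l')%:Z by exact: loadz.
have cnt1 v : B v -> u != v -> (cnt v l' <= 1)%N.
  move=> Bv uv; apply: count_fiber_le1; first by case/andP: ul'.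
  by have := nB v; rewrite Bv eq_sym uv.
have load_sgb v : load (fun e => - sgb s * z e) v = load z v.
  by apply: eq_bigr => e _; congr (_ * _); rewrite /sgb; case: (s); lia.
clearbody cnt.
exists u, (fun e => - sgb s * z e); split=> //; split.
- by move=> e /suppz ->; rewrite mulr0.
- by move=> v; rewrite bdZ bdz ll /sgb; case: (s) => /=; ring.
- by move=> v; rewrite load_sgb; move: (load_le v) (cnt2 v) (cntE v) (cntE' v); lia.
- move=> v Bv; rewrite load_sgb.
  move: (load_le v) (cnt2 v) (cntE v) (cntE' v).
  by case: (eqVneq u v) => [_|/(cnt1 v Bv)]; lia.
- transitivity (\sum_e par (z e) * N e); last by rewrite parz ll; case: (s).
  apply: eq_bigr => e _; congr (_ * _); rewrite /par rmorphM /=.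
  by rewrite (_ : (- sgb s)%:~R = 1 :> bool) ?mul1r //; case: (s).
Qed.

(** Up to the boundary, the value of a non-loop is balanced by the other half edges at its end; a
    loop counts twice in the load anyway. *)
Lemma load_bound (z : E -> int) e b :
  2 * `|z e| <= load z (ep e b) + `|bd z (ep e b)|.
Proof.
set v := ep e b.
have ge0 f : 0 <= ((ep f false == v)%:R + (ep f true == v)%:R : int) by lia.
have le_inc f : `|inc ep tau f v| <= (ep f false == v)%:R + (ep f true == v)%:R.
  rewrite /inc; move: (tauP f false) (tauP f true).
  by case: (ep f false == v); case: (ep f true == v) => /=; lia.
have rest : `|\sum_(f | f != e) z f * inc ep tau f v| <=
    \sum_(f | f != e) `|z f| * ((ep f false == v)%:R + (ep f true == v)%:R).
  apply: le_trans (ler_norm_sum _ _ _) _; apply: ler_sum => f _.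
  by rewrite normrM; apply: ler_wpM2l.
rewrite /load (bigD1 e) //= /bd [in X in _ <= _ + X](bigD1 e) //=.
move: rest; set S := \sum_(f | _) _; set T := \sum_(f | _) _ => rest.
have : (ep e false == v) || (ep e true == v) by rewrite /v; case: (b); rewrite eqxx ?orbT.
rewrite /inc; move: (tauP e false) (tauP e true).
case: (ep e false == v); case: (ep e true == v) => //= hf ht _.
- by case: hf ht => -> [] ->; lia.
- by case: hf => ->; lia.
- by case: ht => ->; lia.
Qed.

End CoverChains.

(** * Disjoint odd subsets of an Eulerian signed graph *)

Lemma sum_pick (I : finType) (R : comNzRingType) (c : I -> R) i :
  \sum_j (j == i)%:R * c j = c i.
Proof.
by rewrite (bigD1 i) //= eqxx mul1r big1 ?addr0 // => j /negbTE ->; rewrite mul0r.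
Qed.

Section OddSubsets.
Variables (V E : finType) (ep : E -> bool -> V).

(** The edges on which a lollipop is odd form an even subset, because its boundary is even; they
    contain an odd number of negative edges. *)
Lemma unbalanced_odd_subset N F v : unbalanced_at ep N F v ->
  exists C : E -> bool, [/\ forall e, C e -> F e, forall v, bd2 ep C v = 0 &
    \sum_e C e * N e = 1].
Proof.
move=> unb; pose tau e b : int := if b && ~~ N e then -1 else 1.
have tauP e b : tau e b = 1 \/ tau e b = -1 by rewrite /tau; case: ifP; auto.
have tauN e b : tau e b * tau e (~~ b) = - sgb (N e).
  by rewrite /tau /sgb; case: b; case: (N e).
have [v1 [z [_ [suppz bdz _ _ parz]]]] :=
  lollipop tauP tauN (B := fun=> true) isT unb.
exists (fun e => par (z e)); split=> // [e|w].
  by case: (boolP (F e)) => // /suppz ->.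
by rewrite -(par_bd _ _ _ tauP) bdz /par rmorphM /= mul0r.
Qed.

(** Consequently switching at [X] preserves the parity of the number of negative edges in an even
    subset. *)
Lemma even_cut C (X : V -> bool) : (forall v, bd2 ep C v = 0) ->
  \sum_e C e * (X (ep e false) + X (ep e true)) = 0.
Proof. by move=> ev; rewrite -(bd2_cut ep) big1 // => v _; rewrite ev mulr0. Qed.

Lemma cut_half (X : V -> bool) e b :
  X (ep e false) + X (ep e true) = X (ep e b) + X (ep e (~~ b)).
Proof. by case: b => //; rewrite addrC. Qed.

(** Ordinary directed flows: an edge runs from its [false] end to its [true] end, and the boundary
    is inflow minus outflow. *)
Definition forward (e : E) (b : bool) : int := sgb (~~ b).

Lemma forwardP e b : forward e b = 1 \/ forward e b = -1.
Proof. by rewrite /forward; case: b; auto. Qed.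

(** The residual graph for capacity one in both directions: the edge can take one more unit from its
    end [b]. *)
Definition residual (H : E -> bool) (phi : E -> int) : rel V := fun u w =>
  [exists e, exists b,
    [&& H e, ep e b == u, ep e (~~ b) == w & sgb b * phi e <= 0]].

(** Distinct vertices force distinct edges, which keeps the values within one; the clause on
    [ep e b] carries this through the induction. *)
Lemma residual_path H phi u l :
  path (residual H phi) u l -> uniq (u :: l) ->
  exists psi : E -> int,
    (forall v, bd ep forward psi v = (v == last u l)%:R - (v == u)%:R) /\
    (forall e, psi e != 0 -> [/\ H e, `|psi e| <= 1, psi e * phi e <= 0 &
       forall b, ep e b \in u :: l]).
Proof.
elim: l u => [|w l IH] u /=.
  by exists (fun=> 0); split=> [v|e]; rewrite ?bd0 ?subrr ?eqxx.
move=> /andP [/existsP [e /existsP [b /and4P [He /eqP eu /eqP ew hphi]]] pl].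
move=> /andP [u_notin ul]; have [psi [bdpsi psiP]] := IH w pl ul.
have psie0 : psi e = 0.
  apply/eqP; apply: contraR u_notin => /psiP [_ _ _ /(_ b)].
  by rewrite eu.
exists (fun f => (if f == e then sgb b else 0) + psi f); split.
  move=> v; rewrite bdD bdpsi bd_delta (inc_half _ _ _ b) eu ew /forward.
  by case: (b) => /=; ring.
move=> f /=; case: (f =P e) => [->|_].
  rewrite psie0 addr0 => _; split=> //; first by case: (b).
  by move=> c; rewrite -eu -ew; case: (b); case: c; rewrite !inE eqxx ?orbT.
rewrite add0r => /psiP [Hf h1 h2 h3]; split=> // c.
by rewrite in_cons h3 orbT.
Qed.

(** One step of the maximum-flow argument. If [v] cannot be reached in the residual graph, the
    reachable set is a cut saturated outwards. *)
Lemma augment (H : E -> bool) (phi : E -> int) u v :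
  (forall e, `|phi e| <= 1) -> (forall e, ~~ H e -> phi e = 0) ->
  (exists phi' : E -> int, [/\ forall e, `|phi' e| <= 1,
     forall e, ~~ H e -> phi' e = 0 &
     forall w, bd ep forward phi' w = bd ep forward phi w + (w == v)%:R - (w == u)%:R]) \/
  (exists X : V -> bool, [/\ X u, ~~ X v &
     forall e b, H e -> X (ep e b) -> ~~ X (ep e (~~ b)) -> sgb b * phi e = 1]).
Proof.
move=> phi1 suppphi; case: (boolP (connect (residual H phi) u v)).
  move=> /connectP [l pl ->]; left.
  case/shortenP: pl => l' pl' ul' _.
  have [psi [bdpsi psiP]] := residual_path pl' ul'.
  exists (fun e => phi e + psi e); split=> [e|e nHe|w].
  - by case: (eqVneq (psi e) 0) => [->|/psiP [_]]; have := phi1 e; nia.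
  - rewrite suppphi // add0r; apply/eqP; apply: contraR nHe.
    by move=> /psiP [].
  - by rewrite bdD bdpsi addrA.
move=> nconn; right; exists (connect (residual H phi) u); split=> // e b He Xe nXe.
have : ~~ (sgb b * phi e <= 0).
  apply: contra nXe => h; apply: connect_trans Xe (connect1 _).
  by apply/existsP; exists e; apply/existsP; exists b; rewrite He !eqxx.
by have := phi1 e; rewrite /sgb; case: b {Xe nXe}; lia.
Qed.

Lemma saturated_cut (H : E -> bool) (phi : E -> int) (X : V -> bool) :
  (forall e, ~~ H e -> phi e = 0) ->
  (forall e b, H e -> X (ep e b) -> ~~ X (ep e (~~ b)) -> sgb b * phi e = 1) ->
  (\sum_e (H e && (X (ep e false) (+) X (ep e true)) : nat))%:Z =
  - \sum_v (X v)%:R * bd ep forward phi v.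
Proof.
move=> supp sat; rewrite bd_dual -sumrN -natz natr_sum; apply: eq_bigr => e _.
rewrite /forward /=; case: (boolP (H e)) => [He|/supp ->]; last by rewrite mul0r.
have := sat e false He; have := sat e true He; rewrite /sgb /=.
case: (X _); case: (X _) => //= h1 h2; rewrite ?mulr0 ?mul0r ?addr0 ?add0r ?subrr //; lia.
Qed.

Lemma sum_bool_eq1 (P : E -> bool) : (\sum_e (P e : nat) = 1)%N ->
  exists p, forall e, P e = (e == p).
Proof.
move=> h; have /card1P [p hp] : #|P| == 1%N.
  by rewrite -sum1_card -h big_mkcond; apply/eqP/eq_bigr => e _; rewrite unfold_in; case: (P e).
by exists p => e; have := hp e; rewrite unfold_in.
Qed.

(** In the first case, switching at [X] leaves [e1] as the only negative edge of [F]. *)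
Definition single_or_disjoint_odd (N F : E -> bool) :=
  (exists e1 (X : V -> bool), F e1 /\
     forall e, F e -> N e + (X (ep e false) + X (ep e true)) = (e == e1)) \/
  (exists C1 C2 : E -> bool,
     [/\ forall e, C1 e -> F e && ~~ C2 e, forall e, C2 e -> F e,
         forall v, bd2 ep C1 v = 0 /\ bd2 ep C2 v = 0,
         \sum_e C1 e * N e = 1 & \sum_e C2 e * N e = 1]).

(* Three negative edges, two of which share the vertex v: either a cut reduces
   them to a single one, or Menger's theorem yields disjoint paths back to v
   from the other ends of these two edges. *)
Lemma adjacent_negative_edges (N F : E -> bool) (X0 : V -> bool) e f g be bf :
  (forall v, bd2 ep F v = 0) -> F e -> F f -> F g ->
  e != f -> e != g -> f != g -> ep e be = ep f bf ->
  ep e (~~ be) != ep e be -> ep f (~~ bf) != ep f bf ->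
  (forall a, F a -> N a + (X0 (ep a false) + X0 (ep a true)) =
     [|| a == e, a == f | a == g]) ->
  single_or_disjoint_odd N F.
Proof.
move=> evF Fe Ff Fg ef eg fg vef; set v := ep e be in vef *.
rewrite -vef; set x := ep e (~~ be); set y := ep f (~~ bf) => xv yv hN.
pose H a := [&& F a, a != e, a != f & a != g].
pose dl (X : V -> bool) a := X (ep a false) + X (ep a true).
have dle X : dl X e = X v + X x by rewrite /dl (cut_half _ _ be).
have dlf X : dl X f = X v + X y by rewrite /dl (cut_half _ _ bf) -vef.
have single (X : V -> bool) p : F p ->
    (forall a, F a -> [|| a == e, a == f | a == g] + dl X a = (a == p)) ->
    single_or_disjoint_odd N F.
  move=> Fp hp; left; exists p, (fun w => X0 w + X w); split=> // a Fa.
  by rewrite -hp // -hN // /dl; ring.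
have notH a : F a -> ~~ H a -> [|| a == e, a == f | a == g].
  by rewrite /H => ->; rewrite !negb_and !negbK.
have tri a : ([|| a == e, a == f | a == g] : bool) =
    (a == e)%:R + (a == f)%:R + (a == g)%:R.
  case: (eqVneq a e) => [->|_]; first by rewrite (negbTE ef) (negbTE eg).
  by case: (eqVneq a f) => [->|_]; [rewrite (negbTE fg) | case: (a == g)].
(* The even set [F] meets the cut of [X] evenly, and of [H] only [p] may cross; this relates the
   crossings of [e], [f] and [g]. *)
have cut_sum (X : V -> bool) (c : bool) p : (c -> H p) ->
    (forall a, H a -> dl X a = c * (a == p)%:R) ->
    dl X e + dl X f + dl X g + c = 0.
  move=> Hp hX; rewrite -(even_cut X evF).
  rewrite -(sum_pick (dl X) e) -(sum_pick (dl X) f) -(sum_pick (dl X) g).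
  rewrite -(sum_pick (fun=> c) p) -!big_split; apply: eq_bigr => a _ /=.
  rewrite -!mulrDl -tri; case: (boolP (H a)) => [Ha|nHa].
    have : [|| a == e, a == f | a == g] = false.
      by move: Ha; rewrite /H; case: (a == e); case: (a == f); case: (a == g); rewrite ?andbF.
    move=> ->; rewrite -/(dl X a) hX // mul0r add0r.
    by move: Ha => /andP [-> _]; rewrite mul1r mulrC.
  have -> : (a == p)%:R * c = 0.
    case: (eqVneq a p) => [ap|_]; last by rewrite mul0r.
    by apply/negbTE; rewrite mul1r; apply: contra nHa => /Hp; rewrite ap.
  rewrite addr0 -/(dl X a); case: (boolP (F a)) => [Fa|nFa].
    by rewrite notH.
  have -> : [|| a == e, a == f | a == g] = false; last by rewrite mul0r.
  by apply: contraNF nFa => /or3P [] /eqP ->.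
have cut_sum0 (X : V -> bool) : (forall a, H a -> dl X a = 0) ->
    dl X e + dl X f + dl X g = 0.
  by move=> hX; rewrite -[LHS]addr0; apply: (cut_sum X false e) => // a /hX ->; rewrite mul0r.
(* Two units are to be sent to [v] within [H], one from [x] and one from [y]. *)
have [||[phi [phi1 suppphi bdphi]]|[X [Xx nXv sat]]] := @augment H (fun=> 0) x v.
- by [].
- by [].
- have [[psi [psi1 supppsi bdpsi]]|[X [Xy nXv sat]]] := augment y v phi1 suppphi.
    have {}bdpsi w : bd ep forward psi w = 2 * (w == v)%:R - (w == x)%:R - (w == y)%:R.
      by rewrite bdpsi bdphi bd0; ring.
    have hx : 0 < -1 * bd ep forward psi x.
      by rewrite bdpsi eqxx (negbTE xv); case: (x == y).
    (* The trail from [x] splits [psi] in two: zero total boundary forces sign 1 at its end, and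
       only [v] has positive boundary. *)
    have [q [w [t [confq tP bdq ht]]]] := conformal_trail forwardP (or_intror erefl) hx.
    have wv : w = v /\ t = 1.
      have : \sum_u (1 : int) * bd ep forward q u = 0.
        by rewrite bd_dual big1 // => a _; rewrite /forward /= !mul1r addNr mulr0.
      under eq_bigr do rewrite mul1r bdq.
      rewrite big_split /= -!mulr_sumr.
      have s1 u : \sum_(i : V) (i == u)%:R = 1 :> int.
        by rewrite (bigD1 u) //= eqxx big1 ?addr0 // => i /negbTE ->.
      rewrite !s1 => ht0; have t1 : t = 1 by lia.
      split=> //; apply/eqP; move: ht; rewrite bdpsi t1.
      by case: (w == v) => //; case: (w == x); case: (w == y); lia.
    case: wv => [wv t1]; rewrite {w}wv {t tP}t1 in bdq ht.
    have qpsi a : q a = 0 \/ q a = psi a.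
      by have := confq a; have := psi1 a; lia.
    have q1 a : `|q a| <= 1 by case: (qpsi a) => ->.
    have suppq a : ~~ H a -> q a = 0 by move=> /supppsi ha; case: (qpsi a) => ->.
    (* [e] closes the part [q] from [x], and [f] closes the rest. The parts are disjoint since [q]
       is 0 or [psi] on each edge. *)
    pose C1 a := par (q a) + (a == e); pose C2 a := par (psi a - q a) + (a == f).
    have He : H e = false by rewrite /H eqxx andbF.
    have Hf : H f = false by rewrite /H eqxx !andbF.
    have Hg : H g = false by rewrite /H eqxx !andbF.
    have C1F a : C1 a -> F a && ~~ C2 a.
      rewrite /C1 /C2; case: (eqVneq a e) => [->|ae].
        by rewrite (suppq e) ?He // (supppsi e) ?He // Fe (negbTE ef).
      rewrite addr0 par_small // => qa; have Ha : H a by apply: contraR qa => /suppq ->.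
      case/and4P: Ha => -> _ /negbTE -> _; rewrite addr0.
      by case: (qpsi a) qa => -> //; rewrite ?eqxx // subrr.
    have C2F a : C2 a -> F a.
      rewrite /C2; case: (eqVneq a f) => [->//|_].
      rewrite addr0 => h; have : H a; last by case/andP.
      by apply: contraLR h => nHa; rewrite suppq // supppsi.
    have ev w : bd2 ep C1 w = 0 /\ bd2 ep C2 w = 0.
      have d1 h : bd2 ep (fun a => (a == h) : bool) w = inc ep (fun _ _ => 1) h w.
        rewrite -[RHS]mul1r -bd_delta; apply: eq_bd => a.
        by case: (a == h).
      split; rewrite /bd2 bdD -!/(bd2 ep _ w) d1 -(par_bd _ _ _ forwardP).
        rewrite bdq (inc_half _ _ _ be) -/v -/x /par !(rmorphD, rmorphM) /=.
        by case: (w == x); case: (w == v).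
      rewrite (inc_half _ _ _ bf) -vef -/y.
      rewrite (eq_bd _ _ _ (_ : _ =1 (fun a => psi a + -1 * q a))); last first.
        by move=> a; rewrite mulN1r.
      rewrite bdD bdZ bdq bdpsi /par !(rmorphD, rmorphM, rmorphN) /=.
      by case: (w == x); case: (w == v); case: (w == y).
    have oddC (C : E -> bool) p : (forall w, bd2 ep C w = 0) -> (forall a, C a -> F a) ->
        (forall a, C a && [|| a == e, a == f | a == g] = (a == p)) -> \sum_a C a * N a = 1.
      move=> evC CF Cp.
      transitivity (\sum_a (C a * N a + C a * (X0 (ep a false) + X0 (ep a true)))).
        by rewrite big_split /= (even_cut X0 evC) addr0.
      rewrite -[RHS](sum_pick (fun=> 1) p); apply: eq_bigr => a _; rewrite -mulrDr mulr1.
      rewrite -Cp; case: (boolP (C a)) => [/CF /hN ->|_]; last by rewrite mul0r.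
      by case: [|| _, _ | _].
    right; exists C1, C2; split=> //.
    + apply: (oddC _ e) => [w|a /C1F /andP []|a] //; first by case: (ev w).
      rewrite /C1; case: (eqVneq a e) => [->|ae] /=.
        by rewrite suppq ?He.
      by case: (eqVneq a f) => [->|af] /=; [|case: (eqVneq a g) => [->|ag] /=];
        rewrite ?andbF // suppq ?Hf ?Hg.
    + apply: (oddC _ f) => [w|a /C2F|a] //; first by case: (ev w).
      rewrite /C2; case: (eqVneq a f) => [->|af] /=.
        by rewrite orbT suppq ?supppsi ?Hf.
      by case: (eqVneq a e) => [->|ae] /=; [|case: (eqVneq a g) => [->|ag] /=];
        rewrite ?andbF // suppq ?supppsi ?He ?Hg.
  have := saturated_cut suppphi sat.
  rewrite (eq_bigr (fun w => (w == v)%:R * (X w)%:R - (w == x)%:R * (X w)%:R)); last first.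
    by move=> w _; rewrite bdphi bd0 add0r mulrBr mulrC [X in _ - X]mulrC.
  rewrite sumrB !sum_pick (negbTE nXv) sub0r opprK => cnt.
  (* The saturated cut has one edge of [H] if [X] contains [x], and none otherwise. In the first
     case this edge [p] crosses together with [e], [f], [g], and switching leaves only [p]; in the
     second only [f] and [g] cross, and [e] remains. *)
  case: (boolP (X x)) cnt => [Xx cnt|nXx cnt].
    have [|p hp] := @sum_bool_eq1 (fun a => H a && (X (ep a false) (+) X (ep a true))).
      by apply/eqP; rewrite -eqz_nat cnt.
    have Hp : H p by have := hp p; rewrite eqxx; case/andP.
    have hX a : H a -> dl X a = 1 * (a == p)%:R.
      by move=> Ha; rewrite mul1r /dl; have := hp a; rewrite Ha /= => <-; case: (X _); case: (X _).
    have := cut_sum X 1 p (fun=> Hp) hX; rewrite dle dlf Xx Xy (negbTE nXv) => hg.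
    have {}hg : dl X g = 1 by move: hg; case: (dl X g).
    apply: (single X p) => [|a Fa]; first by case/andP: Hp.
    case: (boolP (H a)) => [Ha|nHa].
      rewrite hX //; move: Ha; rewrite /H => /and4P [_ /negbTE -> /negbTE -> /negbTE ->] /=.
      by case: (a == p).
    have ap : (a == p) = false by apply: contraNF nHa => /eqP ->.
    by rewrite ap; move/or3P: (notH a Fa nHa) => [] /eqP ->;
      rewrite eqxx ?orbT ?dle ?dlf ?hg ?Xx ?Xy ?(negbTE nXv).
  have hX a : H a -> dl X a = 0.
    move=> Ha; move/eqP: cnt; rewrite eqz_nat sum_nat_eq0 => /forallP /(_ a).
    by rewrite Ha /dl /=; case: (X _); case: (X _).
  have := cut_sum0 X hX; rewrite dle dlf (negbTE nXx) Xy (negbTE nXv) => hg.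
  have {}hg : dl X g = 1 by move: hg; case: (dl X g).
  apply: (single X e) => // a Fa; case: (boolP (H a)) => [Ha|nHa].
    by rewrite hX //; move: Ha; rewrite /H => /and4P [_ /negbTE -> /negbTE -> /negbTE ->].
  move/or3P: (notH a Fa nHa) => [] /eqP ->; rewrite ?eqxx ?orbT ?dle ?dlf ?hg ?(negbTE nXx) ?Xy ?(negbTE nXv) //.
    by rewrite eq_sym (negbTE ef).
  by rewrite eq_sym (negbTE eg).
(* A cut saturated by the zero flow has no edge of [H]. So [e] and exactly one of [f], [g] cross,
   and the other stays negative. *)
have hX a : H a -> dl X a = 0.
  move=> Ha; rewrite /dl; have := sat a false Ha; have := sat a true Ha => /=.
  by case: (X _); case: (X _) => //= h1 h2; [have := h1 isT isT | have := h2 isT isT].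
have := cut_sum0 X hX; rewrite dle Xx (negbTE nXv) => hfg.
have {}hfg : dl X f + dl X g = 1 by move: hfg; case: (dl X g); case: (dl X f).
case: (boolP (dl X f)) => df; have dg : dl X g = ~~ dl X f.
- by move: hfg; rewrite df; case: (dl X g).
- apply: (single X g) => // a Fa; case: (boolP (H a)) => [Ha|nHa].
    by rewrite hX //; move: Ha; rewrite /H => /and4P [_ /negbTE -> /negbTE -> /negbTE ->].
  move/or3P: (notH a Fa nHa) => [] /eqP ->; rewrite ?eqxx ?orbT ?dle ?Xx ?dg ?df ?(negbTE nXv) //.
    by rewrite (negbTE eg).
  by rewrite (negbTE fg).
- by move: hfg; rewrite (negbTE df); case: (dl X g).
- apply: (single X f) => // a Fa; case: (boolP (H a)) => [Ha|nHa].
    by rewrite hX //; move: Ha; rewrite /H => /and4P [_ /negbTE -> /negbTE -> /negbTE ->].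
  move/or3P: (notH a Fa nHa) => [] /eqP ->; rewrite ?eqxx ?orbT ?dle ?Xx ?dg ?(negbTE df) ?(negbTE nXv) //.
    by rewrite (negbTE ef).
  by rewrite eq_sym (negbTE fg).
Qed.

End OddSubsets.

(* Induction on the number of edges, splitting off two edges at a vertex. *)
Lemma single_or_disjoint_oddP (V E : finType) (ep : E -> bool -> V) (N F : E -> bool) :
  (forall v, bd2 ep F v = 0) -> \sum_e F e * N e = 1 ->
  single_or_disjoint_odd ep N F.
Proof.
have [n le_n] : exists n, (#|F| <= n)%N by exists #|F|.
elim: n ep N F le_n => [|n IH] ep N F le_n evF oddF.
  have F0 e : F e = false.
    have := card0_eq (A := F) _ e; rewrite !inE unfold_in; apply.
    by apply/eqP; rewrite -leqn0.
  by move: oddF; rewrite big1 // => e _; rewrite F0 mul0r.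
have card_rem e : F e -> (#|(fun a => F a && (a != e))| <= n)%N.
  move=> Fe; rewrite -ltnS -add1n; apply: leq_trans le_n.
  rewrite (@cardD1 _ e F) unfold_in Fe leq_add2l; apply: eq_leq; apply: eq_card => a.
  by rewrite !inE !unfold_in andbC.
have [e Fe] : exists e, F e.
  apply/existsP; move: oddF; apply: contra_eqT; rewrite negb_exists => /forallP F0.
  by rewrite big1 // => e _; rewrite (negbTE (F0 e)) mul0r.
case: (eqVneq (ep e false) (ep e true)) => [loop|nloop].
  pose F' a := F a && (a != e).
  have inc0 v : inc ep (fun _ _ => 1 : bool) e v = 0.
    by rewrite /inc loop; case: eqP.
  have evF' v : bd2 ep F' v = 0.
    have := evF v; rewrite /bd2 /bd (bigD1 e) //= inc0 mulr0 add0r => h.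
    rewrite (bigD1 e) //= inc0 mulr0 add0r -[RHS]h; apply: eq_bigr => a /negbTE ae.
    by rewrite /F' ae andbT.
  have sumF' : \sum_a F a * N a = N e + \sum_a F' a * N a.
    rewrite (bigD1 e) //= [in RHS](bigD1 e) //= {1}/F' eqxx andbF mul0r add0r Fe mul1r.
    by congr (_ + _); apply: eq_bigr => a /negbTE ae; rewrite /F' ae andbT.
  case: (boolP (N e)) => Ne; last first.
    have [//||[e1 [X [/andP [Fe1 e1e] hX]]]|[C1 [C2 [s1 s2 ev o1 o2]]]] := IH ep N F' (card_rem e Fe).
    - by rewrite -oddF sumF' (negbTE Ne) add0r.
    - left; exists e1, X; split=> // a Fa; case: (eqVneq a e) => [->|ae].
        by rewrite loop (negbTE Ne) eq_sym (negbTE e1e); case: (X _).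
      by apply: hX; rewrite /F' Fa.
    - right; exists C1, C2; split=> // [a /s1 /andP [/andP [-> _] ->]|a /s2 /andP []] //.
  (* A negative loop is an odd even subset by itself; the rest supplies a disjoint one unless it is
     balanced. *)
  case: (boolP [exists v, unbalanced_at ep N F' v]) => [/existsP [v unb]|]; last first.
    rewrite negb_exists => /forallP bal; have [X hX] := potential ep N F'.
    left; exists e, X; split=> // a Fa; case: (eqVneq a e) => [->|ae].
      by rewrite loop Ne; case: (X _).
    by rewrite (hX a) ?bal // /F' ?Fa //; case: (X _); case: (X _).
  have [C [CF evC oddC]] := unbalanced_odd_subset unb.
  right; exists (fun a => a == e), C; split=> //.
  - move=> a /eqP ->; rewrite Fe /=; apply/negP => /CF.
    by rewrite /F' eqxx andbF.
  - by move=> a /CF /andP [].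
  - move=> w; split=> //; rewrite -[RHS](inc0 w) -[RHS]mul1r -bd_delta.
    by apply: eq_bd => a; case: (a == e).
  - rewrite -[RHS]Ne -(sum_pick N e); apply: eq_bigr => a _.
    by case: (a == e).
(* The end [ep e false] has even degree in [F], so besides [e] another edge that is not a loop ends
   there. *)
have [f /and3P [Ff fe fv]] : exists f, [&& F f, f != e &
    inc ep (fun _ _ => 1 : bool) f (ep e false)].
  set v := ep e false in nloop *; have := evF v.
  rewrite /bd2 /bd (bigD1 e) //= Fe {1}/inc eqxx eq_sym (negbTE nloop) => h.
  apply/existsP; move: h; apply: contra_eqT; rewrite negb_exists => /forallP h.
  rewrite big1 // => f fe; have := h f; rewrite fe /=.
  by case: (F f) => //=; case: (inc _ _ _ _).
have [bf [fbf fbf']] : exists bf, ep f bf = ep e false /\ ep f (~~ bf) != ep e false.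
  move: fv; rewrite /inc; case: eqP => h1; case: eqP => h2 // _.
    by exists false; split=> //; apply/eqP.
  by exists true; split=> //; apply/eqP.
set v := ep e false in nloop fbf fbf'.
pose x := ep e true; pose y := ep f (~~ bf).
(* Splitting off: [e] now joins the far ends [x] and [y] with the product of the two signs, and [f]
   is deleted. [lift] replaces the new edge by the pair [e], [f]. *)
pose ep' a (b : bool) := if a == e then (if b then x else y) else ep a b.
pose F' a := F a && (a != f); pose N' a := if a == e then N e + N f else N a.
pose lift (C : E -> bool) a := if a == f then C e else C a.
have ef : (e == f) = false by rewrite eq_sym (negbTE fe).
have two (G1 G2 : E -> bool) : (forall a, a != e -> a != f -> G1 a = G2 a) ->
    G1 e + G1 f = G2 e + G2 f -> \sum_a G1 a = \sum_a G2 a.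
  move=> h h2; rewrite (bigD1 e) //= (bigD1 f) //= [RHS](bigD1 e) //= [in RHS](bigD1 f) //=.
  by rewrite !addrA h2; congr (_ + _); apply: eq_bigr => a /andP [h3 h4]; apply: h.
have bd_lift (C : E -> bool) w : C f = false -> bd2 ep (lift C) w = bd2 ep' C w.
  move=> Cf; apply: two => [a ae af|].
    by rewrite /lift (negbTE af) /inc /ep' (negbTE ae).
  rewrite /lift ef eqxx Cf mul0r addr0 !(inc_half _ _ e false) (inc_half _ _ f bf).
  rewrite /ep' eqxx /= fbf -/v -/x -/y.
  by case: (C e); case: (w == v); case: (w == x); case: (w == y).
have odd_lift (C : E -> bool) : C f = false -> \sum_a lift C a * N a = \sum_a C a * N' a.
  move=> Cf; apply: two => [a ae af|].
    by rewrite /lift (negbTE af) /N' (negbTE ae).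
  by rewrite /lift /N' eqxx ef eqxx Cf mul0r addr0 mulrDr.
have F'f : F' f = false by rewrite /F' eqxx andbF.
have liftF' a : lift F' a = F a.
  by rewrite /lift /F'; case: (eqVneq a f) => [->|_]; rewrite ?Fe ?ef ?Ff ?andbT.
have [||[e1 [X [Fe1 hX]]]|[C1 [C2 [s1 s2 ev o1 o2]]]] := IH ep' N' F' (card_rem f Ff).
- by move=> w; rewrite -bd_lift // -[RHS](evF w); apply: eq_bd.
- by rewrite -odd_lift // -[RHS]oddF; apply: eq_bigr => a _; rewrite liftF'.
- case/andP: Fe1 => Fe1 e1f.
  pose d a := N a + (X (ep a false) + X (ep a true)).
  have hd a : F a -> a != e -> a != f -> d a = (a == e1).
    by move=> Fa ae af; rewrite -hX /F' ?Fa // /N' /ep' (negbTE ae).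
  have hef : d e + d f = (e == e1).
    rewrite -hX /F' ?Fe ?ef // /N' /ep' eqxx /d (cut_half ep X f bf) fbf -/v -/x -/y.
    by case: (N e); case: (N f); case: (X v); case: (X x); case: (X y).
  (* [d] is the signature switched at [X]. If [e] and [f] are both negative, there are three
     negative edges with [e1]; otherwise only one is left. *)
  case: (boolP (d e)) hef => de; case: (boolP (d f)) => df hef.
  + case: (eqVneq e e1) hef => // ee1 _.
    apply: (@adjacent_negative_edges _ _ ep N F X e f e1 false bf) => //.
    * by rewrite ef.
    * by rewrite eq_sym.
    * by rewrite eq_sym.
    * by rewrite fbf.
    * move=> a Fa; case: (eqVneq a e) => [->|ae]; first exact: de.
      by case: (eqVneq a f) => [->|af]; [exact: df | exact: hd].
  + left; exists e, X; split=> // a Fa; case: (eqVneq a e) => [->//|ae].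
    case: (eqVneq a f) => [->|af]; first by rewrite -/(d f) (negbTE df).
    have e1e : e = e1 by apply/eqP; move: hef; case: (_ == _).
    by rewrite -/(d a) hd // -e1e (negbTE ae).
  + left; exists f, X; split=> // a Fa; case: (eqVneq a f) => [->//|af].
    case: (eqVneq a e) => [->|ae]; first by rewrite -/(d e) (negbTE de).
    have e1e : e = e1 by apply/eqP; move: hef; case: (_ == _).
    by rewrite -/(d a) hd // -e1e (negbTE ae).
  + left; exists e1, X; split=> // a Fa.
    case: (eqVneq a e) hef => [->|ae]; first by rewrite -/(d e) (negbTE de); case: (_ == _).
    by case: (eqVneq a f) => [-> _|af _]; [rewrite -/(d f) (negbTE df); apply/esym/negbTE; rewrite eq_sym | apply: hd].
have C1f : C1 f = false by apply/negP => /s1; rewrite F'f.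
have C2f : C2 f = false by apply/negP => /s2; rewrite F'f.
right; exists (lift C1), (lift C2); split.
- move=> a; rewrite /lift; case: eqP => [->|_]; last by move=> /s1 /andP [/andP [-> _] ->].
  by move=> /s1 /andP [_ ->]; rewrite Ff.
- by move=> a; rewrite /lift; case: eqP => [->//|_] /s2 /andP [].
- by move=> w; rewrite !bd_lift.
- by rewrite odd_lift.
- by rewrite odd_lift.
Qed.

(** * Flows of the contracted graph *)

Section ParityFlow.
Variables (V E : finType) (ep : E -> bool -> V) (tau : E -> bool -> int).
Variable N : E -> bool.
Hypothesis tauP : forall e b, tau e b = 1 \/ tau e b = -1.
Hypothesis tauN : forall e b, tau e b * tau e (~~ b) = - sgb (N e).
Local Notation bd := (bd ep tau).

Lemma tau_true e : tau e true = - sgb (N e) * tau e false.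
Proof. by rewrite -(tauN e false) mulrAC tau_sq // mul1r. Qed.

Lemma par_add_even (a b : int) : par (a + 2 * b) = par a.
Proof. by rewrite /par rmorphD rmorphM /= mul0r addr0. Qed.

Lemma bd_even_half (x : E -> int) : (forall v, par (bd x v) = 0) ->
  exists beta : V -> int, forall v, bd x v = 2 * beta v.
Proof.
move=> h; have/fin_all_exists := fun v => par_spec (bd x v).
by case=> beta hb; exists beta => v; rewrite hb h addr0.
Qed.

(* Half the boundary of x is pushed to one root in each component. There it is
   even, and cancelled by a lollipop if the component is unbalanced; in a balanced
   component it vanishes. *)
Lemma parity_flow (F : E -> bool) (x : E -> int) :
  (forall e, ~~ F e -> x e = 0) -> (forall v, par (bd x v) = 0) ->
  (forall r, \sum_e connect (adj ep F) r (ep e false) * (par (x e) * N e) = 0) ->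
  exists g : E -> int, [/\ forall e, ~~ F e -> g e = 0, forall v, bd g v = 0 &
    forall e, par (g e) = par (x e)].
Proof.
move=> suppx evx comp_ev; have [beta hbeta] := bd_even_half evx.
pose rt := fingraph.root (adj ep F).
have rtP v : connect (adj ep F) v (rt v) by exact: connect_root.
have rt_eq u v : connect (adj ep F) u v -> rt u = rt v.
  by move/(fingraph.rootP (adj_sym ep F)).
(* [p v] carries a unit from [v] to the root of its component, possibly with a changed sign. *)
have /fin_all_exists [p hp] v : exists z : E -> int, (forall e, ~~ F e -> z e = 0) /\
    exists c : int, forall w, bd z w = c * (w == rt v)%:R - (w == v)%:R.
  have [t /connectP [l pl ll]] := connect_lift N false (rtP v).
  have [z [suppz bdz _ _]] := cover_path_chain tauP tauN pl.
  exists z; split=> //; exists (sgb t) => w.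
  by rewrite bdz -ll /= mul1r.
have {hp} [suppp /fin_all_exists [c bdp]] : (forall v e, ~~ F e -> p v e = 0) /\
    forall v, exists c : int, forall w, bd (p v) w = c * (w == rt v)%:R - (w == v)%:R.
  by split=> v; case: (hp v).
pose g1 e := x e + 2 * \sum_v beta v * p v e.
pose m w := \sum_v beta v * c v * (w == rt v)%:R.
have bd_g1 w : bd g1 w = 2 * m w.
  rewrite bdD bdZ bd_bigsum hbeta -mulrDr; congr (2 * _).
  have -> : \sum_v bd (fun e => beta v * p v e) w =
      \sum_v (beta v * c v * (w == rt v)%:R - (v == w)%:R * beta v).
    by apply: eq_bigr => v _; rewrite bdZ bdp [w == v]eq_sym; ring.
  by rewrite sumrB sum_pick addrC subrK.
have suppg1 e : ~~ F e -> g1 e = 0.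
  by move=> nF; rewrite /g1 suppx // big1 ?mulr0 // => v _; rewrite suppp ?mulr0.
have parg1 e : par (g1 e) = par (x e) by exact: par_add_even.
have m_off w : rt w != w -> m w = 0.
  move=> h; rewrite /m big1 // => v _; case: eqP => [wv|_]; last by rewrite mulr0.
  by move: h; rewrite {1}wv -(rt_eq _ _ (rtP v)) -wv eqxx.
(* With [s = 1] only negative edges contribute, each an even amount, which gives the parity of
   [m r]. With the switching signs of a balanced component no edge contributes. *)
have comp_sum (s : V -> int) r : rt r = r ->
    2 * (s r * m r) = \sum_e (connect (adj ep F) r (ep e false))%:R * g1 e * tau e false *
      (s (ep e false) - sgb (N e) * s (ep e true)).
  move=> rr; pose S v : int := (connect (adj ep F) r v)%:R.
  transitivity (\sum_v (S v * s v) * bd g1 v).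
    rewrite (bigD1 r) //= /S connect0 mul1r bd_g1 big1; first by ring.
    move=> v vr; case: (boolP (connect _ _ _)) => [rv|_]; last by rewrite !mul0r.
    rewrite bd_g1 m_off ?mulr0 // -(rt_eq _ _ rv) rr eq_sym //.
  rewrite bd_dual; apply: eq_bigr => e _; case: (boolP (F e)) => [Fe|/suppg1 ->]; last first.
    by rewrite mulr0 !mul0r.
  have -> : S (ep e true) = S (ep e false).
    have st := connect1 (adj_edge ep false Fe).
    by rewrite /S; congr (nat_of_bool _)%:R; apply/idP/idP => h; apply: connect_trans h _;
      rewrite // adj_sym.
  by rewrite tau_true -/(S _); ring.
have /fin_all_exists [y hy] r : exists y : E -> int, (forall e, ~~ F e -> y e = 0) /\
    forall w, bd y w = - m r * (w == r)%:R.
  case: (eqVneq (rt r) r) => [rr|/m_off ->]; last first.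
    by exists (fun=> 0); split=> // w; rewrite bd0 oppr0 mul0r.
  case: (boolP (unbalanced_at ep N F r)) => [unb|bal].
    have [v1 [z [/eqP -> [suppz bdz _ _ _]]]] :=
      lollipop tauP tauN (B := fun w => w == r) (eqxx r) unb.
    have m_even : par (m r) = 0.
      have -> : m r = \sum_e (connect (adj ep F) r (ep e false))%:R * g1 e * tau e false * (N e)%:R.
        apply: (@mulfI _ 2) => //; have := comp_sum (fun=> 1) r rr.
        rewrite mul1r => ->; rewrite mulr_sumr; apply: eq_bigr => e _.
        by rewrite /sgb; case: (N e) => /=; ring.
      rewrite -[RHS](comp_ev r) /par rmorph_sum /=; apply: eq_bigr => e _.
      rewrite !rmorphM /= -/(par (g1 e)) parg1 -/(par (x e)).
      by case: (tauP e false) => ->; case: (connect _ _ _); case: (N e); case: (par (x e)).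
    have [q mq] := par_spec (m r); rewrite m_even addr0 in mq.
    exists (fun e => - q * z e); split=> [e /suppz ->|w]; first by rewrite mulr0.
    by rewrite bdZ bdz mq; ring.
  have [X hX] := potential ep N F.
  have m0 : m r = 0.
    have := comp_sum (fun v => sgb (X v)) r rr; rewrite big1.
      by move=> /eqP; rewrite !mulf_eq0 /sgb; case: (X r) => /= /eqP.
    move=> e _; case: (boolP (F e)) => [Fe|/suppg1 ->]; last by rewrite mulr0 !mul0r.
    case: (boolP (connect _ _ _)) => [re|_]; last by rewrite !mul0r.
    have nb : ~~ unbalanced_at ep N F (ep e false).
      by apply: contra bal; apply: (unbalanced_connect (u := ep e false)); rewrite // adj_sym.
    rewrite (hX e Fe nb).
    by rewrite /sgb; case: (X (ep e false)); case: (X (ep e true)); rewrite /= subrr mulr0.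
  by exists (fun=> 0); split=> // w; rewrite bd0 m0 oppr0 mul0r.
exists (fun e => g1 e + 2 * \sum_r y r e); split=> [e nF|v|e].
- by rewrite suppg1 // big1 ?mulr0 // => r _; case: (hy r) => ->.
- rewrite bdD bdZ bd_bigsum bd_g1 -mulrDr (_ : \sum_r bd (y r) v = - m v) ?subrr ?mulr0 //.
  rewrite -[RHS](sum_pick (fun r => - m r) v); apply: eq_bigr => r _.
  by case: (hy r) => _ ->; rewrite eq_sym mulrC.
- by rewrite par_add_even.
Qed.

End ParityFlow.

Lemma connect_exit (T : finType) (r : rel T) (P : pred T) x y :
  connect r x y -> P x -> ~~ P y -> exists u w, [/\ r u w, P u & ~~ P w].
Proof.
move=> /connectP [l pl ->] {y}; elim: l x pl => [|z l IH] x /=; first by move=> _ ->.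
move=> /andP [xz zl] Px nP; case: (boolP (P z)) => Pz; first exact: IH zl Pz nP.
by exists x, z.
Qed.

(** The encoding [k * n.+1 + (n - k')] rewards a larger [k] first and then a smaller [k']. *)
Lemma lex_ltl k1 k2 k3 k4 n :
  (k1 < k2 -> k1 * n.+1 + (n - k3) < k2 * n.+1 + (n - k4))%N.
Proof.
move=> lt12; apply: (@leq_trans (k1.+1 * n.+1)%N); first by rewrite mulSn; lia.
by apply: leq_trans (leq_addr _ _); rewrite leq_mul2r lt12 orbT.
Qed.

Lemma lex_ltr k1 k2 k3 k4 n :
  (k1 <= k2 -> k4 < k3 -> k3 <= n -> k1 * n.+1 + (n - k3) < k2 * n.+1 + (n - k4))%N.
Proof.
move=> le12 lt43 le3; have : (k1 * n.+1 <= k2 * n.+1)%N by rewrite leq_mul2r le12 orbT.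
by lia.
Qed.

(** * Extremal choice of an odd even subset *)

Section OddEvenSubsets.
Variables (V E : finType) (ep : E -> bool -> V) (N : E -> bool).

Lemma unbalanced_edge F v : unbalanced_at ep N F v -> exists e b, F e /\ ep e b = v.
Proof.
move=> /connectP [[|q l] //= /andP [/cover_adjP [e [b [Fe h _ _]]] _] _].
by exists e, b.
Qed.

Lemma adj_mono (F F' : E -> bool) : (forall e, F e -> F' e) ->
  forall u w, connect (adj ep F) u w -> connect (adj ep F') u w.
Proof. by move=> h u w; apply: connect_component => e /h. Qed.

Lemma cover_mono (F F' : E -> bool) v : (forall e, F e -> F' e) ->
  unbalanced_at ep N F v -> unbalanced_at ep N F' v.
Proof. by move=> h; apply: cover_connect_component => e /h. Qed.

Lemma even_restrict (D : E -> bool) (S : V -> bool) v :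
  (forall e, D e -> S (ep e false) = S (ep e true)) ->
  bd2 ep (fun e => D e && S (ep e false)) v = S v * bd2 ep D v.
Proof.
move=> hS; rewrite /bd2 /bd mulr_sumr; apply: eq_bigr => e _.
case: (boolP (D e)) => [/hS hSe|_]; last by rewrite !mul0r mulr0.
rewrite /= mul1r /inc; case: eqP => [<-|_]; case: eqP => [<-|_]; rewrite ?hSe ?mulr0 ?addr0 //.
Qed.

Lemma component_stable (D : E -> bool) r e : D e ->
  connect (adj ep D) r (ep e false) = connect (adj ep D) r (ep e true).
Proof.
move=> De; have st := connect1 (adj_edge ep false De).
apply/idP/idP => h; apply: connect_trans h _; first exact: st.
by rewrite adj_sym.
Qed.

(** Were [C] balanced, a potential would turn its number of negative edges into a cut count, which
    is even. *)
Lemma odd_subset_unbalanced (C : E -> bool) : (forall v, bd2 ep C v = 0) ->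
  \sum_e C e * N e = 1 -> exists v, unbalanced_at ep N C v.
Proof.
move=> evC; have [X hX] := potential ep N C => oddC.
apply/existsP; move: oddC; apply: contra_eqT; rewrite negb_exists => /forallP bal.
rewrite (eq_bigr (fun e => C e * (X (ep e false) + X (ep e true)))); last first.
  move=> e _; case: (boolP (C e)) => [Ce|_]; last by rewrite !mul0r.
  by rewrite (hX e Ce (bal _)).
by rewrite (even_cut X evC).
Qed.

Variable F : E -> bool.
Hypothesis evF : forall v, bd2 ep F v = 0.
Hypothesis connF : forall e e', F e -> F e' -> connect (adj ep F) (ep e false) (ep e' false).
Hypothesis oddF : \sum_e F e * N e = 1.

Definition good_cut (c : {ffun E -> bool} * V) : bool :=
  [&& [forall e, c.1 e ==> F e], [forall v, bd2 ep c.1 v == 0], \sum_e c.1 e * N e &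
      unbalanced_at ep N (fun e => F e && ~~ c.1 e) c.2].

Definition cut_size (c : {ffun E -> bool} * V) : nat :=
  (#|[pred v | connect (adj ep (fun e => F e && ~~ c.1 e)) c.2 v]| * #|E|.+1
   + (#|E| - #|[pred e | c.1 e]|))%N.

(* C is chosen so that the component of r in F - C is as large as possible:
   an odd even subset disjoint from C and from that component would do better. *)
Lemma extremal_cut :
  ~ (exists e1 (X : V -> bool), F e1 /\
     forall e, F e -> N e + (X (ep e false) + X (ep e true)) = (e == e1)) ->
  exists (C : E -> bool) r, let D := fun e => F e && ~~ C e in
    [/\ [/\ forall e, C e -> F e, forall v, bd2 ep C v = 0 & \sum_e C e * N e = 1],
        unbalanced_at ep N D r,
        forall v, \sum_e connect (adj ep D) v (ep e false) * (D e * N e) = 0 &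
        forall C0 : E -> bool, (forall e, C0 e -> C e) -> (forall v, bd2 ep C0 v = 0) ->
          \sum_e C0 e * N e = 1 -> forall e, C e -> C0 e].
Proof.
move=> nosingle; have [/nosingle []|] := single_or_disjoint_oddP evF oddF.
move=> [C1 [C2 [C1F C2F ev12 odd1 odd2]]].
have ffun_good (C : E -> bool) r : (forall e, C e -> F e) -> (forall v, bd2 ep C v = 0) ->
    \sum_e C e * N e = 1 -> unbalanced_at ep N (fun e => F e && ~~ C e) r ->
    good_cut ([ffun e => C e], r).
  move=> CF evC oddC unb; apply/and4P; split.
  - by apply/forallP => e; rewrite ffunE; apply/implyP/CF.
  - by apply/forallP => v; rewrite -(evC v); apply/eqP/eq_bd => e; rewrite ffunE.
  - by rewrite (eq_bigr (fun e => C e * N e)) ?oddC // => e _; rewrite ffunE.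
  - by apply: cover_mono unb => e /=; rewrite ffunE.
have [r1 unb1] : exists r, unbalanced_at ep N (fun e => F e && ~~ C1 e) r.
  have [r unb] := @odd_subset_unbalanced C2 (fun v => proj2 (ev12 v)) odd2.
  exists r; apply: cover_mono unb => e C2e; rewrite C2F //=.
  by apply/negP => /C1F; rewrite C2e andbF.
have good1 : good_cut ([ffun e => C1 e], r1).
  by apply: ffun_good => // [e /C1F /andP []|v] //; case: (ev12 v).
case: (arg_maxnP cut_size good1) => -[C r] /and4P [/= /forallP CF' /forallP evC' oddC unb] max.
have CF e : C e -> F e by have /implyP := CF' e.
have evC v : bd2 ep C v = 0 by apply/eqP.
have {}max c : good_cut c -> (cut_size c <= cut_size (C, r))%N by move=> /max.
clear CF' evC' C1 C2 C1F C2F ev12 odd1 odd2 r1 unb1 good1.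
pose D e := F e && ~~ C e; pose K v := connect (adj ep D) r v.
have evD v : bd2 ep D v = 0.
  rewrite -[RHS](addr0 0) -{1}(evF v) -(evC v) -bdD; apply: eq_bd => e.
  by rewrite /D; have := CF e; case: (F e); case: (C e) => // /(_ isT).
have oddD : \sum_e D e * N e = 0.
  rewrite -[RHS](_ : 1 + 1 = _) // -{1}oddF -[X in _ = _ + X]oddC -big_split.
  apply: eq_bigr => e _; rewrite /= -mulrDl; congr (_ * _).
  by rewrite /D; have := CF e; case: (F e); case: (C e) => // /(_ isT).
(* Since [F] is connected, an edge outside the component [K] forces an edge leaving [K], which must
   lie in [C]. *)
have exit (e : E) : F e -> ~~ K (ep e false) ->
    exists a b, [/\ C a, K (ep a b) & ~~ K (ep a (~~ b))].
  move=> Fe nKe; have [a [b [/andP [Fa _] ab]]] := unbalanced_edge unb.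
  have re : connect (adj ep F) r (ep e false).
    apply: connect_trans (connF Fa Fe); rewrite -ab.
    by case: (b); [rewrite adj_sym; exact: connect1 (adj_edge _ false _) | exact: connect0].
  have [u [w [/adjP [a' [b' [Fa' au aw]]] Ku nKw]]] := connect_exit re (connect0 _ r : K r) nKe.
  exists a', b'; rewrite au aw; split=> //; apply: contraR nKw => nCa.
  apply: connect_trans Ku (connect1 _); rewrite -au -aw; apply: adj_edge.
  by rewrite /D Fa'.
(* Removing [C2] instead of [C] would keep [K] and add a vertex reached by an edge of [C] that
   leaves it. *)
have no_odd (C2 : E -> bool) : (forall e, C2 e -> D e) -> (forall v, bd2 ep C2 v = 0) ->
    \sum_e C2 e * N e = 1 -> (forall e, C2 e -> ~~ K (ep e false)) -> False.
  move=> C2D ev2 odd2 C2K; pose D2 e := F e && ~~ C2 e.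
  have DD2 e : D e -> K (ep e false) -> D2 e.
    by move=> /andP [Fe _] Ke; rewrite /D2 Fe /=; apply: contraL Ke => /C2K.
  have KK2 v : K v -> connect (adj ep D2) r v by exact: connect_component.
  have unb2 : unbalanced_at ep N D2 r by exact: cover_connect_component unb.
  have good2 : good_cut ([ffun e => C2 e], r).
    by apply: ffun_good => // e /C2D /andP [].
  have := max _ good2; rewrite /cut_size /= leqNgt => /negP; apply.
  have [e2 C2e2] : exists e, C2 e.
    apply/existsP; move: odd2; apply: contra_eqT; rewrite negb_exists => /forallP h.
    by rewrite big1 // => e _; rewrite (negbTE (h e)) mul0r.
  have [|a [b [Ca Ka nKa]]] := exit e2 _ (C2K _ C2e2); first by case/andP: (C2D _ C2e2).
  have lt_card : (#|[pred v | K v]| <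
      #|[pred v | connect (adj ep (fun e => F e && ~~ [ffun e => C2 e] e)) r v]|)%N.
    apply: proper_card; apply/properP; split.
      apply/subsetP => v; rewrite !inE => /KK2; apply: adj_mono => e.
      by rewrite ffunE.
    exists (ep a (~~ b)); rewrite !inE //; apply: connect_trans (_ : connect _ r (ep a b)) _.
      by move: (KK2 _ Ka); apply: adj_mono => e; rewrite ffunE.
    apply/connect1/adj_edge; rewrite ffunE CF //=; apply/negP => /C2D.
    by rewrite /D Ca andbF.
  exact: lex_ltl lt_card.
exists C, r; split=> //.
- move=> v; rewrite -/D.
  case odd_v: (\sum_e connect (adj ep D) v (ep e false) * (D e * N e)) => //; exfalso.
  (* [D] has an even number of negative edges, so if [K] carries an odd number, the rest of [D] does
     too. *)
  case: (boolP (K v)) => Kv.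
    have KS u : connect (adj ep D) v u = K u.
      by apply/idP/idP; apply: connect_trans; rewrite // adj_sym.
    apply: (no_odd (fun e => D e && ~~ K (ep e false))) => [e /andP []|w||e /andP []] //.
      rewrite (even_restrict (S := fun u => ~~ K u)) ?evD ?mulr0 // => e De.
      by rewrite /K (component_stable r De).
    transitivity (\sum_e D e * N e + \sum_e connect (adj ep D) v (ep e false) * (D e * N e)).
      rewrite -big_split; apply: eq_bigr => e _; rewrite /= KS.
      by case: (D e); case: (K _); case: (N e).
    by rewrite oddD odd_v.
  apply: (no_odd (fun e => D e && connect (adj ep D) v (ep e false))) => [e /andP []|w||e] //.
  + rewrite even_restrict ?evD ?mulr0 // => e De; exact: component_stable.
  + rewrite -[RHS]odd_v; apply: eq_bigr => e _.
    by case: (D e); case: (connect _ _ _); case: (N e).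
  + move=> /andP [De ve]; apply: contra Kv => Ke; apply: connect_trans Ke _.
    by rewrite adj_sym.
(* A smaller odd subset leaves a component at least as large, so the second criterion decides. *)
- move=> C0 C0C ev0 odd0 e Ce; apply: contraT => nC0e; exfalso.
  pose D0 a := F a && ~~ C0 a.
  have DD0 a : D a -> D0 a.
    by rewrite /D /D0 => /andP [-> nCa]; apply: contra nCa; exact: C0C.
  have good0 : good_cut ([ffun e => C0 e], r).
    by apply: ffun_good => // [a /C0C /CF //|]; exact: cover_mono unb.
  have := max _ good0; rewrite /cut_size /= leqNgt => /negP; apply.
  have le_card : (#|[pred v | K v]| <=
      #|[pred v | connect (adj ep (fun e => F e && ~~ [ffun e => C0 e] e)) r v]|)%N.
    apply: subset_leq_card; apply/subsetP => v; rewrite !inE; apply: adj_mono => a.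
    by rewrite ffunE; exact: DD0.
  have lt_card : (#|[pred e | [ffun e => C0 e] e]| < #|[pred e | C e]|)%N.
    apply: proper_card; apply/properP; split.
      by apply/subsetP => a; rewrite !inE ffunE; exact: C0C.
    by exists e; rewrite !inE // ffunE.
  have le_E : (#|[pred e | C e]| <= #|E|)%N by exact: max_card.
  exact: lex_ltr le_card lt_card le_E.
Qed.

End OddEvenSubsets.

Section ContractedFlows.
Variables (V E : finType) (ep : E -> bool -> V) (tau : E -> bool -> int).
Variables (N F : E -> bool).
Hypothesis tauP : forall e b, tau e b = 1 \/ tau e b = -1.
Hypothesis tauN : forall e b, tau e b * tau e (~~ b) = - sgb (N e).
Hypothesis evF : forall v, bd2 ep F v = 0.
Hypothesis connF : forall e e', F e -> F e' -> connect (adj ep F) (ep e false) (ep e' false).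
Hypothesis oddF : \sum_e F e * N e = 1.
Hypothesis nosingle :
  ~ (exists e1 (X : V -> bool), F e1 /\
     forall e, F e -> N e + (X (ep e false) + X (ep e true)) = (e == e1)).
Local Notation bd := (bd ep tau).
Local Notation load := (load ep).

Lemma par_odd_norm (m : int) : par m -> 1 <= `|m|.
Proof. by have [q hq] := par_spec m; move=> h; rewrite h in hq; lia. Qed.

Lemma loadN (z : E -> int) (c : int) v : c = 1 \/ c = -1 ->
  load (fun e => c * z e) v = load z v.
Proof.
by move=> cP; apply: eq_bigr => e _; rewrite normrM (_ : `|c| = 1) ?mul1r //; lia.
Qed.

(* On a minimal odd even subset C the odd part of a lollipop contained in C is
   all of C, so that C has degree 2 at each of its vertices and the lollipop is
   +-1 on C. *)
Lemma minimal_odd_chain (C : E -> bool) v0 :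
  (forall C0 : E -> bool, (forall e, C0 e -> C e) -> (forall v, bd2 ep C0 v = 0) ->
          \sum_e C0 e * N e = 1 -> forall e, C e -> C0 e) ->
  (forall v, bd2 ep C v = 0) -> \sum_e C e * N e = 1 ->
  (exists e b, C e /\ ep e b = v0) ->
  exists z : E -> int, [/\ forall e, ~~ C e -> z e = 0, forall v, bd z v = 2 * (v == v0)%:R,
    forall e, C e -> z e != 0 &
    forall v, load z v <= 2].
Proof.
move=> minC evC oddC hv0.
have tree v : (exists e b, C e /\ ep e b = v) -> exists z : E -> int,
    [/\ forall e, ~~ C e -> z e = 0, forall w, bd z w = 2 * (w == v)%:R,
        forall e, C e -> par (z e), forall w, load z w <= 4 & load z v <= 2].
  move=> [e [b [Ce eb]]].
  have [O1 unb1] := odd_subset_unbalanced evC oddC.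
  pose C' a := C a && connect (adj ep C) O1 (ep a false).
  have unb1' : unbalanced_at ep N C' O1.
    by apply: cover_connect_component unb1 => a Ca h; rewrite /C' Ca.
  have [C0 [C0C' ev0 odd0]] := unbalanced_odd_subset unb1'.
  have conn : connect (adj ep C) O1 v.
    have : C0 e by apply: minC => // a /C0C' /andP [].
    move=> /C0C' /andP [_ h]; rewrite -eb; case: (b) => //.
    by rewrite -component_stable.
  have unbv := unbalanced_connect conn unb1.
  have [v1 [z [/eqP v1v [suppz bdz load4 loadB oddz]]]] :=
    lollipop tauP tauN (B := fun w => w == v) (eqxx v) unbv.
  exists z; split=> //; first by rewrite -v1v.
    apply: minC => // [a|w]; first by apply: contraLR => /suppz ->.
    by rewrite -(par_bd _ _ _ tauP) bdz /par rmorphM /= mul0r.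
  exact: loadB.
have [z [suppz bdz parz load4 load2]] := tree _ hv0.
(* The loads and the boundary bound [z] by 2, and [z] is odd on [C]. *)
have z1 e : `|z e| = (C e)%:R.
  case: (boolP (C e)) => [Ce|/suppz ->]; last by rewrite normr0.
  have := load_bound ep tauP z e false; rewrite bdz.
  have h1 := par_odd_norm (parz e Ce); have := load4 (ep e false).
  have [q hq] := par_spec (z e); rewrite parz //= in hq.
  by case: eqP => [ev|_] /=; [move: load2; rewrite -ev |]; lia.
exists z; split=> // [e Ce|v]; first by have := z1 e; rewrite Ce; lia.
(* A lollipop based at [v] has load at most 2 there and dominates [z] in absolute value. *)
case: (boolP [exists e, C e && ((ep e false == v) || (ep e true == v))]) => [/existsP|].
  move=> [e /andP [Ce ev]].
  have [|z' [_ _ parz' _ load2']] := tree v.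
    by case/orP: ev => /eqP ev; exists e; [exists false | exists true].
  apply: le_trans load2'; apply: ler_sum => a _; rewrite z1; apply: ler_wpM2r; first by lia.
  case: (boolP (C a)) => [Ca|_]; last exact: normr_ge0.
  exact: par_odd_norm (parz' a Ca).
rewrite negb_exists => /forallP h; rewrite /load big1 // => e _; rewrite z1.
have := h e; case: (C e) => /=; last by rewrite mul0r.
by rewrite negb_or => /andP [/negbTE -> /negbTE ->]; rewrite mulr0.
Qed.

(** [w] is the difference of a chain on [C] and a lollipop off [C] with the same boundary at a
    common vertex. Its load is at most 2 + 2 at vertices of [C], and elsewhere that of the
    lollipop. *)
Lemma contracted_flows : exists (C : E -> bool) (g w : E -> int),
  [/\ forall e, C e -> F e,
      [/\ forall e, ~~ (F e && ~~ C e) -> g e = 0, forall v, bd g v = 0 &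
          forall e, F e -> ~~ C e -> par (g e)] &
      [/\ forall e, ~~ F e -> w e = 0, forall v, bd w v = 0,
          forall e, C e -> w e != 0 & forall v, load w v <= 4]].
Proof.
have [C [r [[CF evC oddC] unb comp_ev minC]]] := extremal_cut evF connF oddF nosingle.
set D := fun e => _ in unb comp_ev.
have [g [suppg bdg parg]] : exists g : E -> int, [/\ forall e, ~~ D e -> g e = 0,
    forall v, bd g v = 0 & forall e, par (g e) = par ((D e)%:R)].
  apply: (parity_flow tauP tauN) => [e /negbTE ->||v] //.
    move=> v; rewrite (par_bd _ _ _ tauP) -[RHS](addr0 0) -{1}(evF v) -(evC v) -bdD.
    apply: eq_bd => e; rewrite /D; have := CF e.
    by case: (F e); case: (C e) => // /(_ isT).
  rewrite -[RHS](comp_ev v); apply: eq_bigr => e _; congr (_ * (_ * _)).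
  by rewrite /par /D; case: (F e && ~~ C e).
have [ec Cec] : exists e, C e.
  apply/existsP; move: oddC; apply: contra_eqT; rewrite negb_exists => /forallP h.
  by rewrite big1 // => e _; rewrite (negbTE (h e)) mul0r.
pose B v := [exists e, exists b, C e && (ep e b == v)].
have BP v : reflect (exists e b, C e /\ ep e b = v) (B v).
  apply: (iffP existsP) => [[e /existsP [b /andP [Ce /eqP eb]]]|[e [b [Ce eb]]]].
    by exists e, b.
  by exists e; apply/existsP; exists b; rewrite Ce eb /=.
(* If the chosen edge of [C] misses the component of [r], a path of [F] towards it leaves that
   component, and does so along an edge of [C]. *)
have [v0 [Bv0 unb0]] : exists v, B v /\ unbalanced_at ep N D v.
  case: (boolP (connect (adj ep D) r (ep ec false))) => [rc|nrc].
    exists (ep ec false); split; first by apply/BP; exists ec, false.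
    exact: unbalanced_connect rc unb.
  have [a [b [/andP [Fa _] ab]]] := unbalanced_edge unb.
  have re : connect (adj ep F) r (ep ec false).
    apply: connect_trans (connF Fa (CF _ Cec)); rewrite -ab.
    by case: (b); [rewrite adj_sym; exact: connect1 (adj_edge _ false _) | exact: connect0].
  have [u [w [/adjP [a' [b' [Fa' au aw]]] Ku nKw]]] :=
    connect_exit (P := connect (adj ep D) r) re (connect0 _ r) nrc.
  exists u; split; last exact: unbalanced_connect Ku unb.
  apply/BP; exists a', b'; split=> //; apply: contraR nKw => nCa.
  apply: connect_trans Ku (connect1 _); rewrite -au -aw; apply: adj_edge.
  by rewrite /D Fa'.
have [v1 [z [/BP Bv1 [suppz bdz load4 loadB _]]]] := lollipop tauP tauN Bv0 unb0.
have [y [suppy bdy y0 load2]] := minimal_odd_chain minC evC oddC Bv1.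
exists C, g, (fun e => y e + -1 * z e); split=> //; split=> //.
- by move=> e Fe nCe; rewrite parg /D Fe nCe.
- move=> e nFe; rewrite suppy ?suppz ?mulr0 ?addr0 //; last by apply: contra nFe; exact: CF.
  by rewrite /D (negbTE nFe).
- by move=> v; rewrite bdD bdZ bdy bdz; ring.
- by move=> e Ce; rewrite suppz ?mulr0 ?addr0 ?y0 // /D Ce andbF.
- move=> v; apply: le_trans (loadD _ _ _ _) _; rewrite loadN; last by right.
  case: (boolP (B v)) => [Bv|nBv]; first by have := loadB v Bv; have := load2 v; lia.
  have -> : load y v = 0; last by rewrite add0r.
  rewrite /load big1 // => e _; case: (boolP (C e)) => [Ce|/suppy ->]; last first.
    by rewrite normr0 mul0r.
  have nb b : ep e b == v = false.
    by apply: contraNF nBv => /eqP eb; apply/BP; exists e, b.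
  by rewrite !nb mulr0.
Qed.

End ContractedFlows.

(** * Lifting to the cubic graph *)

Section Contraction.
Variables (V E : finType) (ep : E -> bool -> V) (A : E -> bool).

Definition contract v := fingraph.root (adj ep A) v.
Definition contract_ep e b := contract (ep e b).

Lemma contract_eq u v : connect (adj ep A) u v -> contract u = contract v.
Proof. by move/(fingraph.rootP (adj_sym ep A)). Qed.

Lemma contract_loop e : A e -> contract (ep e false) = contract (ep e true).
Proof. by move=> Ae; apply/contract_eq/connect1/(adj_edge ep false Ae). Qed.

Lemma bd_contract (R : comNzRingType) (tau : E -> bool -> R) z w :
  bd contract_ep tau z w = \sum_v (contract v == w)%:R * bd ep tau z v.
Proof.
rewrite bd_dual; apply: eq_bigr => e _; congr (_ * _).
by rewrite /inc /contract_ep; do 2 case: eqP => _; rewrite ?mul1r ?mul0r.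
Qed.

Lemma bd2_loops (C : E -> bool) w : (forall e, C e -> A e) -> bd2 contract_ep C w = 0.
Proof.
move=> CA; rewrite /bd2 /bd big1 // => e _; case: (boolP (C e)) => [/CA Ae|_]; last first.
  by rewrite mul0r.
by rewrite mul1r /inc /contract_ep contract_loop //; case: eqP.
Qed.

Variables (tau : E -> bool -> int) (N : E -> bool).
Hypothesis tauP : forall e b, tau e b = 1 \/ tau e b = -1.
Hypothesis tauN : forall e b, tau e b * tau e (~~ b) = - sgb (N e).
Hypothesis posA : forall e, A e -> N e = false.

(** The boundary of [z] sums to zero over each component of [A], so it can be collected at the
    representative along paths of [A]. As these edges are positive, no sign changes on the way. *)
Lemma contracted_flow_lift (z : E -> int) :
  (forall w, bd contract_ep tau z w = 0) ->
  exists y : E -> int, (forall e, ~~ A e -> y e = 0) /\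
    forall v, bd ep tau (fun e => z e + y e) v = 0.
Proof.
move=> flowz.
have /fin_all_exists [p hp] v : exists z : E -> int, (forall e, ~~ A e -> z e = 0) /\
    forall w, bd ep tau z w = (w == contract v)%:R - (w == v)%:R.
  have [t /connectP [l pl ll]] := connect_lift N false (connect_root (adj ep A) v).
  have [x [suppx bdx _ _]] := cover_path_chain tauP tauN pl.
  exists x; split=> // w; rewrite bdx -ll /= mul1r; congr (_ - _).
  suff -> : sgb t = 1 by rewrite mul1r.
  have : \sum_u (1 : int) * bd ep tau x u = 0.
    rewrite bd_dual big1 // => e _; case: (boolP (A e)) => [Ae|/suppx ->]; last by rewrite mul0r.
    by rewrite (tau_true tauP tauN) posA //; ring.
  under eq_bigr do rewrite mul1r bdx -ll /= mul1r.
  have s1 u : \sum_(i : V) (i == u)%:R = 1 :> int.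
    by rewrite (bigD1 u) //= eqxx big1 ?addr0 // => i /negbTE ->.
  by rewrite sumrB -mulr_sumr !s1 mulr1 => /eqP; rewrite subr_eq0 => /eqP.
exists (fun e => \sum_v bd ep tau z v * p v e); split=> [e nA|w].
  by rewrite big1 // => v _; case: (hp v) => -> //; rewrite mulr0.
rewrite bdD bd_bigsum -[RHS](flowz w) bd_contract.
have -> : \sum_v bd ep tau (fun e => bd ep tau z v * p v e) w =
    \sum_v ((contract v == w)%:R * bd ep tau z v - (v == w)%:R * bd ep tau z v).
  apply: eq_bigr => v _; rewrite bdZ; case: (hp v) => _ ->.
  by rewrite [w == v]eq_sym [w == _]eq_sym; ring.
by rewrite sumrB sum_pick addrC subrK.
Qed.

End Contraction.

Section CubicColouring.
Variables (V E : finType) (ep : E -> bool -> V) (col : E -> 'I_3).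
Variable half : V -> 'I_3 -> E * bool.
Hypothesis half_end : forall v c, ep (half v c).1 (half v c).2 = v.
Hypothesis half_col : forall v c, col (half v c).1 = c.
Hypothesis halfK : forall h : E * bool, half (ep h.1 h.2) (col h.1) = h.

Lemma bd_colour (R : comNzRingType) (tau : E -> bool -> R) z v :
  bd ep tau z v = \sum_c tau (half v c).1 (half v c).2 * z (half v c).1.
Proof.
rewrite bd_halves (reindex_onto (half v) (fun h => col h.1)) /=; last first.
  by move=> h /eqP <-; exact: halfK.
by apply: eq_bigl => c; rewrite half_end half_col !eqxx.
Qed.

Lemma three_colours (i j k c : 'I_3) : i != j -> i != k -> j != k -> [|| c == i, c == j | c == k].
Proof.
rewrite -!val_eqE /= => ij ik jk.
by move: (ltn_ord i) (ltn_ord j) (ltn_ord k) (ltn_ord c); lia.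
Qed.

Lemma sum_three (R : nmodType) (phi : 'I_3 -> R) i j k : i != j -> i != k -> j != k ->
  \sum_c phi c = phi i + phi j + phi k.
Proof.
move=> ij ik jk; rewrite (bigD1 i) //= (bigD1 j) 1?eq_sym //= (bigD1 k) /=; last first.
  by rewrite eq_sym ik eq_sym jk.
rewrite big1 ?addr0 ?addrA // => c /andP [/andP [ci cj] ck].
by have := three_colours c ij ik jk; rewrite (negbTE ci) (negbTE cj) (negbTE ck).
Qed.

End CubicColouring.

(** * Flows on one connected component *)

Section OneComponent.
Variables (V E : finType) (ep : E -> bool -> V) (r0 : V).

Definition in_comp v := connect (adj ep (fun=> true)) r0 v.
Definition comp_edge e := in_comp (ep e false).

Lemma comp_edge_end e b : in_comp (ep e b) = comp_edge e.
Proof. by case: b => //; rewrite /comp_edge /in_comp -component_stable. Qed.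

Lemma comp_connect u w : in_comp u -> in_comp w -> connect (adj ep comp_edge) u w.
Proof.
move=> ru rw; have h v : in_comp v -> connect (adj ep comp_edge) r0 v.
  by apply: connect_component.
by apply: connect_trans (h w rw); rewrite adj_sym; apply: h.
Qed.

Lemma comp_sum (D : E -> bool) (phi : E -> bool) r : (forall e, D e -> comp_edge e) ->
  \sum_e D e * phi e = 0 ->
  \sum_e connect (adj ep comp_edge) r (ep e false) * (D e * phi e) = 0.
Proof.
move=> DK sumD; case: (boolP (in_comp r)) => Kr.
  rewrite -[RHS]sumD; apply: eq_bigr => e _.
  case: (boolP (D e)) => [/DK Ke|_]; last by rewrite !mul0r mulr0.
  by rewrite comp_connect // mul1r.
rewrite big1 // => e _; case: (boolP (D e)) => [/DK Ke|_]; last by rewrite mul0r mulr0.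
case: (boolP (connect _ _ _)) => [re|_]; last by rewrite mul0r.
case/negP: Kr; apply: connect_trans Ke _; rewrite adj_sym.
exact: adj_mono re.
Qed.

Variables (tau : E -> bool -> int) (N : E -> bool).
Hypothesis tauP : forall e b, tau e b = 1 \/ tau e b = -1.
Hypothesis tauN : forall e b, tau e b * tau e (~~ b) = - sgb (N e).

Lemma even_subset_flow (D : E -> bool) :
  (forall e, D e -> comp_edge e) -> (forall v, bd2 ep D v = 0) -> \sum_e D e * N e = 0 ->
  exists g : E -> int, [/\ forall e, ~~ comp_edge e -> g e = 0,
    forall v, bd ep tau g v = 0, forall e, `|g e| <= 2 & forall e, par (g e) = D e].
Proof.
move=> DK evD evN.
have parD e : par ((D e)%:R) = D e by case: (D e).
have [|||g0 [supp0 flow0 par0]] :=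
  @parity_flow _ _ ep tau N tauP tauN comp_edge (fun e => (D e)%:R).
- by move=> e; case: (boolP (D e)) => [/DK ->|].
- by move=> v; rewrite (par_bd _ _ _ tauP) -[RHS](evD v); apply: eq_bd.
- move=> r; rewrite -[RHS](comp_sum r DK evN); apply: eq_bigr => e _.
  by rewrite parD.
have [g [flowg le2 parg suppg]] := reduce_mod2 tauP flow0.
exists g; split=> // e; first by move=> /supp0 /suppg.
by rewrite parg par0 parD.
Qed.

(** In [g1 + 3 g2] an odd [g1] is 1 or -1, hence no multiple of 3; otherwise [g2] is 1 or -1 and
    [g1] is too small to cancel 3. *)
Lemma two_cover_flow (D1 D2 : E -> bool) :
  (forall e, comp_edge e = D1 e || D2 e) ->
  (forall v, bd2 ep D1 v = 0) -> (forall v, bd2 ep D2 v = 0) ->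
  \sum_e D1 e * N e = 0 -> \sum_e D2 e * N e = 0 ->
  exists f : E -> int, [/\ forall e, ~~ comp_edge e -> f e = 0,
    forall v, bd ep tau f v = 0, forall e, `|f e| <= 9 & forall e, comp_edge e -> f e != 0].
Proof.
move=> cover ev1 ev2 odd1 odd2.
have [|g1 [supp1 flow1 le1 par1]] := even_subset_flow _ ev1 odd1.
  by move=> e D1e; rewrite cover D1e.
have [|g2 [supp2 flow2 le2 par2]] := even_subset_flow _ ev2 odd2.
  by move=> e D2e; rewrite cover D2e orbT.
exists (fun e => g1 e + 3 * g2 e); split=> [e nK|v|e|e].
- by rewrite supp1 ?supp2.
- by rewrite bdD bdZ flow1 flow2.
- by move: (le1 e) (le2 e); clear; lia.
- rewrite cover -par1 -par2 => h.
  have [q1 h1] := par_spec (g1 e); have [q2 h2] := par_spec (g2 e).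
  move: (le1 e) (le2 e) h h1 h2; clear.
  by case: (par _); case: (par _) => //= *; lia.
Qed.

End OneComponent.

(** * Circuits of two colours and lifts with small values *)

Lemma three_thresholds (S T1 T2 T3 : int) : 2 <= T1 -> 2 <= T2 -> 2 <= T3 ->
  T1 + T2 + T3 <= S -> S <= 4 -> False.
Proof. lia. Qed.

Lemma threshold_jump (a b m : int) :
  ((m + 1 <= a) (+) (m + 1 <= b))%:R + ((m + 2 <= a) (+) (m + 2 <= b))%:R +
  ((m + 3 <= a) (+) (m + 3 <= b))%:R <= `|a - b|.
Proof.
by case: (leP (m + 1) a); case: (leP (m + 1) b); case: (leP (m + 2) a); case: (leP (m + 2) b);
  case: (leP (m + 3) a); case: (leP (m + 3) b) => /=; lia.
Qed.

Section TwoColours.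
Variables (V E : finType) (ep : E -> bool -> V) (col : E -> 'I_3).
Variable half : V -> 'I_3 -> E * bool.
Hypothesis half_end : forall v c, ep (half v c).1 (half v c).2 = v.
Hypothesis half_col : forall v c, col (half v c).1 = c.
Hypothesis halfK : forall h : E * bool, half (ep h.1 h.2) (col h.1) = h.
Variables (i j k : 'I_3).
Hypotheses (ij : i != j) (ik : i != k) (jk : j != k).
Variable r0 : V.
Local Notation comp_edge := (comp_edge ep r0).
Local Notation in_comp := (in_comp ep r0).
(** In the component, colours [i] and [j] form disjoint circuits and colour [k] a perfect
    matching. *)
Definition factor e := comp_edge e && (col e != k).
Definition matching e := comp_edge e && (col e == k).

Lemma bd_three (R : comNzRingType) (tau : E -> bool -> R) z v :
  bd ep tau z v = tau (half v i).1 (half v i).2 * z (half v i).1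
    + tau (half v j).1 (half v j).2 * z (half v j).1
    + tau (half v k).1 (half v k).2 * z (half v k).1.
Proof. by rewrite (bd_colour half_end half_col halfK) (sum_three _ ij ik jk). Qed.

Lemma comp_edge_half v c : comp_edge (half v c).1 = in_comp v.
Proof. by rewrite -(comp_edge_end _ _ _ (half v c).2) half_end. Qed.

Lemma even_two_colours (P : pred 'I_3) v :
  bd2 ep (fun e => comp_edge e && P (col e)) v = in_comp v * (P i + P j + P k).
Proof.
by rewrite /bd2 bd_three !mul1r !comp_edge_half !half_col; case: (in_comp v).
Qed.

Lemma factor_half v c : factor (half v c).1 = in_comp v && (c != k).
Proof. by rewrite /factor comp_edge_half half_col. Qed.

Lemma factor_colour e : factor e -> col e = i \/ col e = j.
Proof.
move=> /andP [_ ek]; have := three_colours (col e) ij ik jk.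
by rewrite (negbTE ek) orbF => /orP [] /eqP; auto.
Qed.

(** A vertex meets [C] in both colours or in none, so [C] has equally many edges of each. *)
Lemma factor_no_odd_subset (C : E -> bool) : (forall e, C e -> factor e) ->
  (forall v, bd2 ep C v = 0) -> \sum_e C e * true = 0.
Proof.
move=> CA evC.
have Ck v : C (half v k).1 = false.
  by apply/negP => /CA; rewrite factor_half eqxx andbF.
have Cij v : C (half v i).1 = C (half v j).1.
  have := evC v; rewrite /bd2 bd_three Ck !mul1r addr0.
  by case: (C _); case: (C _).
pose cnt c : int := \sum_e (C e && (col e == c))%:R.
have cntE c : \sum_v ((C (half v c).1)%:R : int) = 2 * cnt c.
  transitivity (\sum_v (1 : int) * bd ep (fun _ _ => 1) (fun e => (C e && (col e == c))%:R) v).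
    apply: eq_bigr => v _; rewrite mul1r (bd_colour half_end half_col halfK) (bigD1 c) //=.
    rewrite half_col eqxx andbT mul1r big1 ?addr0 // => d dc.
    by rewrite half_col (negbTE dc) andbF mulr0.
  rewrite bd_dual mulr_sumr; apply: eq_bigr => e _.
  by rewrite !mul1r mulrC.
have cntij : cnt i = cnt j.
  by apply: (@mulfI _ 2) => //; rewrite -!cntE; apply: eq_bigr => v _; rewrite Cij.
have -> : \sum_e C e * true = par (cnt i + cnt j).
  rewrite /cnt -big_split /par rmorph_sum; apply: eq_bigr => e _ /=.
  case: (boolP (C e)) => [/CA /factor_colour [] ->|_] //=; rewrite eqxx.
    by rewrite (negbTE ij).
  by rewrite eq_sym (negbTE ij).
by rewrite cntij -mulr2n -mulr_natl /par rmorphM /= mul0r.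
Qed.

Variables (tau : E -> bool -> int) (N : E -> bool).
Hypothesis tauP : forall e b, tau e b = 1 \/ tau e b = -1.
Hypothesis tauN : forall e b, tau e b * tau e (~~ b) = - sgb (N e).
Hypothesis posA : forall e, factor e -> N e = false.

Definition colour_sign e : int := if col e == i then 1 else -1.

(** The circuits have even length, so the potential of the all-negative signature 2-colours their
    vertices; [s] is this colouring. At each vertex the contributions of colours [i] and [j] are
    then opposite. *)
Lemma alternating_flow : exists (s : V -> int) (f : E -> int),
  [/\ forall v, s v * s v = 1, forall e, ~~ factor e -> f e = 0 &
      forall e b, factor e -> tau e b * f e = colour_sign e * s (ep e b)].
Proof.
have [X hX] := potential ep (fun=> true) factor.
have {}hX e : factor e -> X (ep e false) + X (ep e true) = true.
  move=> Ae; rewrite -hX //; apply/negP => /unbalanced_odd_subset [C [CA evC]].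
  by rewrite factor_no_odd_subset.
exists (fun v => sgb (X v)).
exists (fun e => if factor e then colour_sign e * tau e false * sgb (X (ep e false)) else 0).
split=> [v|e /negbTE -> //|e b Ae]; first by rewrite /sgb; case: (X v).
rewrite Ae; case: b.
  rewrite (tau_true tauP tauN) posA //.
  have -> : sgb (X (ep e true)) = - sgb (X (ep e false)).
    by have := hX e Ae; rewrite /sgb; case: (X _); case: (X _).
  by rewrite -[RHS]mulr1 -(tau_sq tauP e false) /sgb; ring.
by rewrite -[RHS]mulr1 -(tau_sq tauP e false); ring.
Qed.

Local Notation cep := (contract_ep ep factor).
Local Notation contract := (contract ep factor).

Lemma contract_comp u v : contract u = contract v -> in_comp u -> in_comp v.
Proof.
move=> uv; have : connect (adj ep factor) u v.
  by apply/(fingraph.rootP (adj_sym ep factor)).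
by move/(@adj_mono _ _ ep factor (fun=> true) (fun _ _ => isT)) => h1 h2; exact: connect_trans h2 h1.
Qed.

Lemma load_contract (w : E -> int) o : (forall e, ~~ matching e -> w e = 0) ->
  load cep w o = \sum_v (contract v == o)%:R * `|w (half v k).1|.
Proof.
move=> suppw.
transitivity (bd cep (fun _ _ => 1) (fun e => `|w e|) o).
  by apply: eq_bigr => e _; congr (_ * _); rewrite /inc; do 2 case: eqP.
rewrite bd_contract; apply: eq_bigr => v _; congr (_ * _).
rewrite bd_three !mul1r [w (half v i).1]suppw ?[w (half v j).1]suppw ?normr0 ?add0r //;
  by rewrite /matching half_col ?(negbTE ik) ?(negbTE jk) andbF.
Qed.

(* Going round a circuit of the factor, each threshold strictly between the
   extreme values of the lift is crossed at least twice, and each crossing is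
   paid for by the load. *)
Lemma small_lift (w : E -> int) :
  (forall e, ~~ matching e -> w e = 0) -> (forall o, bd cep tau w o = 0) ->
  (forall o, load cep w o <= 4) ->
  exists y : E -> int, [/\ forall e, ~~ factor e -> y e = 0,
    forall v, bd ep tau (fun e => w e + y e) v = 0 & forall e, `|y e| <= 1].
Proof.
move=> suppw floww load4.
have [y [suppy flowy]] := contracted_flow_lift tauP tauN posA floww.
have [s [f [s2 suppf fE]]] := alternating_flow.
have f2 e : factor e -> f e * f e = 1.
  move=> Ae; have := fE e false Ae; have := s2 (ep e false); rewrite /colour_sign.
  have := tauP e false; clear; move: (s _) (tau _ _) (f e) => a t x tP aa.
  by case: ifP => _; case: tP => -> h; nia.
(* [U] measures [y] in units of the alternating flow; by conservation it jumps at a vertex by the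
   value of [w] on the matching edge. *)
pose U e := y e * f e.
have yU e : y e = U e * f e.
  rewrite /U -mulrA; case: (boolP (factor e)) => [/f2 ->|nA]; first by rewrite mulr1.
  by rewrite suppy ?mul0r.
have tauf v c : c != k -> in_comp v ->
    tau (half v c).1 (half v c).2 * f (half v c).1 = (if c == i then 1 else -1) * s v.
  move=> ck Kv; rewrite fE ?factor_half ?Kv //.
  by rewrite /colour_sign half_col half_end.
have jump v : `|U (half v i).1 - U (half v j).1| = `|w (half v k).1|.
  have w0 c : c != k -> w (half v c).1 = 0.
    by move=> ck; apply: suppw; rewrite /matching half_col (negbTE ck) andbF.
  have yk : y (half v k).1 = 0 by apply: suppy; rewrite factor_half eqxx andbF.
  have := flowy v; rewrite bd_three (w0 i) // (w0 j) // yk !add0r addr0.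
  case: (boolP (in_comp v)) => [Kv|nKv].
    rewrite (yU (half v i).1) (yU (half v j).1) !(mulrCA (tau _ _)) !tauf // eqxx eq_sym (negbTE ij).
    have := tauP (half v k).1 (half v k).2; have := s2 v; clear.
    move: (s v) (U _) (U _) (w _) (tau _ _) => a u1 u2 x t aa tP h.
    have [] : a = 1 \/ a = -1 by nia.
      by move=> ea; move: h; rewrite ea; case: tP => ->; lia.
    by move=> ea; move: h; rewrite ea; case: tP => ->; lia.
  rewrite /U !suppy ?factor_half ?(negbTE nKv) // !mul0r !mulr0.
  by case: (tauP (half v k).1 (half v k).2) => ->; lia.
have range e e' : factor e -> factor e' ->
    contract (ep e false) = contract (ep e' false) -> U e' <= U e + 2.
  move=> Ae Ae' ee'; rewrite leNgt; apply/negP => lt_U.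
  set o := contract (ep e false) in ee'.
  have Ko v : contract v = o -> in_comp v.
    move=> vo; apply: (contract_comp (esym vo)).
    by case/andP: Ae.
  pose up (t : int) a := factor a && (t <= U a).
  pose cross t v := up t (half v i).1 (+) up t (half v j).1.
  have crossE t v : contract v = o -> cross t v = (t <= U (half v i).1) (+) (t <= U (half v j).1).
    by move=> vo; rewrite /cross /up !factor_half Ko // ik jk.
  (* Crossings are the vertices of odd degree in [up t], so their number is even. It is not zero,
     since a path of the factor joins [e'] above the threshold to [e] below it. *)
  have twice t : U e < t -> t <= U e' ->
      2 <= \sum_v (contract v == o)%:R * (cross t v)%:R :> int.
    move=> lt_t le_t; set S := \sum_v _.
    have S0 : 0 <= S by apply: sumr_ge0 => v _; apply: mulr_ge0; exact: ler0n.
    have parS : par S = 0.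
      rewrite -[RHS](_ : bd2 cep (up t) o = 0); last by apply: bd2_loops => a /andP [].
      rewrite /bd2 bd_contract /par rmorph_sum; apply: eq_bigr => v _.
      rewrite rmorphM /=; congr (_ * _); first by case: eqP.
      have upk : up t (half v k).1 = false by rewrite /up factor_half eqxx andbF.
      rewrite bd_three !mul1r upk addr0 /cross.
      by case: (up _ _); case: (up _ _).
    have nS : S != 0.
      apply/negP => /eqP S0'.
      have nocross v : contract v = o -> cross t v = false.
        move=> vo; apply/negP => cv.
        have /eqP := S0'; rewrite /S (bigD1 v) //= vo eqxx cv mul1r.
        have : 0 <= \sum_(u | u != v) (contract u == o)%:R * (cross t u)%:R :> int.
          by apply: sumr_ge0 => u _; apply: mulr_ge0; exact: ler0n.
        by move: (\sum_(u | _) _) => x; clear; lia.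
      have upE a b : factor a -> contract (ep a b) = o -> up t (half (ep a b) i).1 = up t a.
        move=> Aa ao; have := halfK (a, b); have := nocross _ ao; rewrite /cross /=.
        by case: (factor_colour Aa) => -> h1 h2; move: h1; rewrite h2 /= //;
          case: (up t _); case: (up t _).
      have conn : connect (adj ep factor) (ep e' false) (ep e false).
        by apply/(fingraph.rootP (adj_sym ep factor)); rewrite -/(contract _) -ee'.
      have [||u [x [/adjP [a [b [Aa au ax]]] /andP [/eqP uo up_u]]]] :=
        connect_exit (P := fun v => (contract v == o) && up t (half v i).1) conn.
      - by rewrite -ee' eqxx upE // /up Ae'.
      - by rewrite eqxx upE // /up Ae /= -ltNge.
      have xo : contract x = o.
        by rewrite -uo -au -ax; case: (b); rewrite /= contract_loop.
      rewrite xo eqxx /= -ax upE ?ax // -(upE a b) ?au //.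
      by rewrite up_u.
    by have [q hq] := par_spec S; rewrite parS addr0 in hq; move: S0 nS hq; clear; lia.
  (* A violation puts three thresholds between [U e] and [U e']; each is crossed twice, which would
     need load 6. *)
  have bound : \sum_v (contract v == o)%:R * (cross (U e + 1) v)%:R +
      \sum_v (contract v == o)%:R * (cross (U e + 2) v)%:R +
      \sum_v (contract v == o)%:R * (cross (U e + 3) v)%:R <= load cep w o.
    rewrite load_contract // -!big_split; apply: ler_sum => v _ /=.
    rewrite -!mulrDr; case: eqP => [vo|_]; last by rewrite !mul0r.
    by rewrite !mul1r !crossE // -jump; exact: threshold_jump.
  apply: (three_thresholds _ _ _ bound (load4 o)); apply: twice;
    move: lt_U; clear; lia.
have /fin_all_exists [t tP] o : exists t : int,
    forall e, factor e -> contract (ep e false) = o -> `|U e - t| <= 1.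
  case: (boolP [exists e, factor e && (contract (ep e false) == o)]) => [/existsP [e0 he0]|].
    pose P e := factor e && (contract (ep e false) == o).
    (* One above the minimum is the midpoint of a range of length 2. *)
    case: (@arg_minP _ _ _ e0 P U he0) => e /andP [Ae /eqP eo] min; exists (U e + 1) => e' Ae' eo'.
    have := min e'; rewrite /P Ae' eo' eqxx => /(_ isT).
    have := range e e' Ae Ae'; rewrite eo eo' => /(_ erefl).
    by clear; lia.
  rewrite negb_exists => /forallP h; exists 0 => e Ae eo.
  by have := h e; rewrite Ae eo eqxx.
(* A multiple of the alternating flow, constant on each circuit, centres the values at zero and
   keeps the boundary. *)
exists (fun e => y e + - t (contract (ep e false)) * f e); split.
- by move=> e nA; rewrite suppy // suppf // mulr0 addr0.
- move=> v; pose z e := - t (contract (ep e false)) * f e.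
  rewrite (eq_bd _ _ _ (_ : _ =1 (fun e => (w e + y e) + z e))); last by move=> e; rewrite addrA.
  rewrite bdD flowy add0r bd_three.
  have -> : z (half v k).1 = 0 by rewrite /z suppf ?mulr0 // factor_half eqxx andbF.
  case: (boolP (in_comp v)) => [Kv|nKv]; last first.
    by rewrite /z !suppf ?factor_half ?(negbTE nKv) // !mulr0 !addr0.
  have zE c : c != k ->
      tau (half v c).1 (half v c).2 * z (half v c).1 = - t (contract v) * ((if c == i then 1 else -1) * s v).
    move=> ck; rewrite /z mulrCA tauf //; congr (- t _ * _).
    have Ah : factor (half v c).1 by rewrite factor_half Kv.
    have := half_end v c; case: (half v c) Ah => a [] /= Aa av; last by rewrite av.
    by rewrite contract_loop // av.
  by rewrite !zE // eqxx eq_sym (negbTE ij); ring.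
- move=> e; case: (boolP (factor e)) => [Ae|nA]; last first.
    by rewrite suppy // suppf // mulr0 addr0 normr0.
  rewrite {1}yU -mulrDl normrM; have := tP _ e Ae erefl; have := f2 e Ae; clear.
  by move: (f e) (U e - _) => x u xx; have [->|->] : x = 1 \/ x = -1; [nia| |]; lia.
Qed.

End TwoColours.

(** * Nowhere-zero flows with values up to 9 on a component *)

Section ComponentFlow.
Variables (V E : finType) (ep : E -> bool -> V) (col : E -> 'I_3).
Variable half : V -> 'I_3 -> E * bool.
Hypothesis half_end : forall v c, ep (half v c).1 (half v c).2 = v.
Hypothesis half_col : forall v c, col (half v c).1 = c.
Hypothesis halfK : forall h : E * bool, half (ep h.1 h.2) (col h.1) = h.
Variable r0 : V.
Local Notation comp_edge := (comp_edge ep r0).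
Local Notation in_comp := (in_comp ep r0).

Definition nonzero_flow9 (tau : E -> bool -> int) (f : E -> int) :=
  [/\ forall e, ~~ comp_edge e -> f e = 0, forall v, bd ep tau f v = 0,
      forall e, `|f e| <= 9 & forall e, comp_edge e -> f e != 0].

(** On circuits ([a]) [g + 2 y] is at most 4 in absolute value, and [5 f] moves it away from zero.
    On the matching the value is [2 w] where [c] holds, and odd elsewhere. *)
Lemma combined_value (g w y f : int) (c a : bool) : `|g| <= 2 -> `|w| <= 2 -> `|y| <= 1 ->
  (if a then w = 0 /\ `|f| = 1 else y = 0 /\ f = 0 /\ (if c then g = 0 /\ w != 0 else par g)) ->
  `|g + 2 * (w + y) + 5 * f| <= 9 /\ g + 2 * (w + y) + 5 * f != 0.
Proof.
case: a => [? ? ? []|]; first by lia.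
case: c => hg hw hy [] y0 [] f0; first by case; lia.
by have [q hq] := par_spec g => pg; rewrite pg /= in hq; lia.
Qed.

Lemma balanced_factor_flow (tau : E -> bool -> int) (N : E -> bool) (i j k : 'I_3) :
  (forall e b, tau e b = 1 \/ tau e b = -1) ->
  (forall e b, tau e b * tau e (~~ b) = - sgb (N e)) ->
  i != j -> i != k -> j != k ->
  (forall e, factor ep col k r0 e -> N e = false) ->
  \sum_e matching ep col k r0 e * N e = 1 ->
  ~ (exists e1 (X : V -> bool), comp_edge e1 /\
     forall e, comp_edge e -> N e + (X (ep e false) + X (ep e true)) = (e == e1)) ->
  exists f, nonzero_flow9 tau f.
Proof.
move=> tauP tauN ij ik jk posA oddM nosingle.
pose A := factor ep col k r0; pose M := matching ep col k r0.
pose cep := contract_ep ep A; pose rt := contract ep A.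
have split_edge e : comp_edge e -> A e = ~~ M e.
  by rewrite /A /M /factor /matching => ->.
(* At each vertex colour [k] has the same degree as colour [i], whose edges become loops. *)
have evM w : bd2 cep M w = 0.
  pose Mi e := comp_edge e && (col e == i).
  have MiA e : Mi e -> A e.
    by rewrite /Mi /A /factor => /andP [-> /eqP ->].
  rewrite -[RHS](bd2_loops ep w MiA) /bd2 !bd_contract; apply: eq_bigr => v _; congr (_ * _).
  rewrite -!/(bd2 ep _ v).
  rewrite (even_two_colours half_end half_col halfK ij ik jk r0 (pred1 k)).
  rewrite (even_two_colours half_end half_col halfK ij ik jk r0 (pred1 i)) /=.
  by rewrite !eqxx (negbTE ik) (negbTE jk) [k == i]eq_sym [j == i]eq_sym (negbTE ik) (negbTE ij).
have connM e e' : M e -> M e' -> connect (adj cep M) (cep e false) (cep e' false).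
  move=> /andP [Ke _] /andP [Ke' _]; have := comp_connect Ke Ke'.
  apply: (connect_map (f := rt)) => u w /adjP [a [b [Ka <- <-]]].
  case: (boolP (M a)) => [Ma|nMa]; first exact/connect1/(adj_edge cep b Ma).
  have Aa : A a by rewrite split_edge.
  by case: (b); rewrite /= /rt (contract_loop _ Aa) connect0.
(* A switching of the contracted graph pulls back to one that is constant on circuits. *)
have nosingleM : ~ (exists e1 (X : V -> bool), M e1 /\
     forall e, M e -> N e + (X (cep e false) + X (cep e true)) = (e == e1)).
  move=> [e1 [X [Me1 hX]]]; apply: nosingle; exists e1, (fun v => X (rt v)).
  split=> [|e Ke]; first by case/andP: Me1.
  case: (boolP (M e)) => [Me|nMe]; first exact: hX.
  have Ae : A e by rewrite split_edge.
  rewrite posA // /rt (contract_loop _ Ae) (_ : e == e1 = false); first by case: (X _).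
  by apply: contraNF nMe => /eqP ->.
have [C [g [w [CM [suppg flowg parg] [suppw floww nzw load4]]]]] :=
  contracted_flows tauP tauN evM connM oddM nosingleM.
have [yg [suppyg flowyg]] := contracted_flow_lift tauP tauN posA flowg.
have [g1 [flowg1 le2 parg1 suppg1]] := reduce_mod2 tauP flowyg.
have [y [suppy flowy le1]] :=
  small_lift half_end half_col halfK ij ik jk tauP tauN posA suppw floww load4.
have [s [f [s2 suppf fE]]] := alternating_flow half_end half_col halfK ij ik jk tauP tauN posA.
have flowf v : bd ep tau f v = 0.
  rewrite (bd_three half_end half_col halfK ij ik jk).
  have fk : f (half v k).1 = 0 by rewrite suppf // /factor half_col eqxx andbF.
  have fc c : c != k -> tau (half v c).1 (half v c).2 * f (half v c).1 =
      (in_comp v)%:R * ((if c == i then 1 else -1) * s v).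
    move=> ck; have := factor_half half_end half_col k r0 v c; rewrite ck andbT.
    case: (in_comp v) => Ac; last by rewrite suppf ?Ac // mulr0 mul0r.
    by rewrite fE // mul1r /colour_sign half_col half_end.
  by rewrite fk !fc // eqxx eq_sym (negbTE ij); ring.
have f1 e : A e -> `|f e| = 1.
  move=> Ae; have := fE e false Ae; have := s2 (ep e false); rewrite /colour_sign.
  have := tauP e false; clear; move: (s _) (tau _ _) (f e) => a t x tP aa.
  have aP : a = 1 \/ a = -1 by nia.
  by case: ifP => _; case: tP => ->; lia.
have lew e : `|w e| <= 2.
  by move: (load_bound cep tauP w e false) (load4 (cep e false)); rewrite floww; clear; lia.
pose F e := g1 e + 2 * (w e + y e) + 5 * f e.
have val e : comp_edge e -> `|F e| <= 9 /\ F e != 0.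
  move=> Ke; apply: (@combined_value _ _ _ _ (C e) (A e)) => //.
  case: (boolP (A e)) => [Ae|nAe].
    by rewrite suppw ?f1 // -/M; move: Ae; rewrite split_edge.
  have Me : M e by move: nAe; rewrite split_edge // negbK.
  split; first exact: suppy.
  split; first exact: suppf.
  case: (boolP (C e)) => [Ce|nCe].
    split; last exact: nzw.
    by rewrite suppg1 // suppg ?suppyg // Me Ce.
  by rewrite parg1 suppyg // addr0 parg.
have off e : ~~ comp_edge e -> F e = 0.
  move=> nK; have nA : ~~ factor ep col k r0 e by rewrite /factor (negbTE nK).
  have nM : ~~ M e by rewrite /M /matching (negbTE nK).
  by rewrite /F suppw // suppy // suppf // suppg1 // suppg ?suppyg // (negbTE nM).
exists F; split=> // [v|e|e Ke]; last by case: (val e Ke).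
- rewrite (eq_bd _ _ _ (_ : F =1 (fun e => (g1 e + 2 * (w e + y e)) + 5 * f e))) //.
  by rewrite bdD bdZ bdD bdZ flowg1 flowy flowf.
- case: (boolP (comp_edge e)) => [Ke|nK]; first by case: (val e Ke).
  by rewrite off.
Qed.

Lemma bool_pigeonhole (n : 'I_3 -> bool) :
  exists i j k : 'I_3, [/\ i != j, i != k, j != k & n i = n j].
Proof.
pose o (m : nat) : 'I_3 := inord m.
have [] : [\/ n (o 0%N) = n (o 1%N), n (o 0%N) = n (o 2%N) | n (o 1%N) = n (o 2%N)].
  by case: (n (o 0%N)); case: (n (o 1%N)); case: (n (o 2%N)); constructor.
- by exists (o 0%N), (o 1%N), (o 2%N); rewrite -!val_eqE /= !inordK.
- by exists (o 0%N), (o 2%N), (o 1%N); rewrite -!val_eqE /= !inordK.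
- by exists (o 1%N), (o 2%N), (o 0%N); rewrite -!val_eqE /= !inordK.
Qed.

Variables (tau : E -> bool -> int) (N : E -> bool).
Hypothesis tauP : forall e b, tau e b = 1 \/ tau e b = -1.
Hypothesis tauN : forall e b, tau e b * tau e (~~ b) = - sgb (N e).

Lemma bd_switch (X : V -> bool) z v :
  bd ep (fun e b => sgb (X (ep e b)) * tau e b) z v = sgb (X v) * bd ep tau z v.
Proof.
rewrite /bd mulr_sumr; apply: eq_bigr => e _; rewrite /inc.
by case: eqP => [<-|_]; case: eqP => [<-|_]; ring.
Qed.

(** Weighting conservation by the switching signs cancels every positive edge and leaves [2 f0 e1]
    up to sign. *)
Lemma no_single_negative (f0 : E -> int) :
  (forall v, bd ep tau f0 v = 0) -> (forall e, f0 e != 0) ->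
  ~ (exists e1 (X : V -> bool), comp_edge e1 /\
     forall e, comp_edge e -> N e + (X (ep e false) + X (ep e true)) = (e == e1)).
Proof.
move=> flow0 nz [e1 [X [Ke1 hX]]].
have : \sum_v ((in_comp v)%:R * sgb (X v)) * bd ep tau f0 v = 0.
  by rewrite big1 // => v _; rewrite flow0 mulr0.
rewrite bd_dual (bigD1 e1) //= big1 => [|e ee1].
  rewrite addr0 !comp_edge_end Ke1 (tau_true tauP tauN).
  have := hX e1 Ke1; have := nz e1; have := tauP e1 false; rewrite eqxx /sgb; clear.
  move: (tau e1 false) (f0 e1) => t x tP x0.
  by case: (N e1); case: (X _); case: (X _) => // _; case: tP => ->; lia.
rewrite !comp_edge_end; case: (boolP (comp_edge e)) => [Ke|_]; last by rewrite !mul0r addr0 mulr0.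
rewrite (tau_true tauP tauN); have := hX e Ke; rewrite (negbTE ee1) /sgb.
by case: (N e); case: (X _); case: (X _) => //= _; ring.
Qed.

Lemma component_flow (f0 : E -> int) :
  (forall v, bd ep tau f0 v = 0) -> (forall e, f0 e != 0) -> exists f, nonzero_flow9 tau f.
Proof.
move=> flow0 nz.
have [i [j [k [ij ik jk eqn]]]] :=
  bool_pigeonhole (fun c => \sum_e (comp_edge e && (col e == c)) * N e).
have even2 (P : pred 'I_3) : P i + P j + P k = 0 ->
    forall v, bd2 ep (fun e => comp_edge e && P (col e)) v = 0.
  move=> hP v; rewrite (even_two_colours half_end half_col halfK ij ik jk) hP.
  exact: mulr0.
(* [D1] has an even number of negative edges by the choice of [i] and [j]; [D2] is its partner
   covering colour [k]. *)
pose D1 e := comp_edge e && (col e != k).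
pose D2 e := comp_edge e && (col e != j).
have ev1 v : bd2 ep D1 v = 0.
  by apply: (even2 (fun c => c != k)); rewrite ik jk eqxx.
have ev2 v : bd2 ep D2 v = 0.
  by apply: (even2 (fun c => c != j)); rewrite ij eqxx eq_sym jk.
have cover e : comp_edge e = D1 e || D2 e.
  rewrite /D1 /D2; case: (comp_edge e) => //=; case: (eqVneq (col e) k) => // ->.
  by rewrite eq_sym jk.
have split2 c d (D : E -> bool) : c != d ->
    (forall e, D e = comp_edge e && ((col e == c) || (col e == d))) ->
    \sum_e D e * N e = \sum_e (comp_edge e && (col e == c)) * N e +
      \sum_e (comp_edge e && (col e == d)) * N e.
  move=> cd hD; rewrite -big_split; apply: eq_bigr => e _ /=; rewrite hD -mulrDl; congr (_ * _).
  by case: (comp_edge e); case: (eqVneq (col e) c) => //= ->; rewrite (negbTE cd).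
have colE c : [|| c == i, c == j | c == k] by exact: three_colours.
have odd1 : \sum_e D1 e * N e = 0.
  rewrite (split2 i j) // => [|e]; first by rewrite eqn; case: (\sum_e _).
  rewrite /D1; case: (eqVneq (col e) k) => [->|ck].
    by rewrite [k == i]eq_sym [k == j]eq_sym (negbTE ik) (negbTE jk) andbF.
  by have := colE (col e); rewrite (negbTE ck) orbF => ->.
case odd2 : (\sum_e D2 e * N e); last exact: (two_cover_flow tauP tauN cover).
case: (boolP [exists v, unbalanced_at ep N D1 v]) => [/existsP [v unb]|].
  have [C [CD1 evC oddC]] := unbalanced_odd_subset unb.
  (* Adding an odd even subset of [D1] modulo 2 repairs the parity of [D2] and leaves colour [k]
     untouched. *)
  apply: (two_cover_flow tauP tauN (D1 := D1) (D2 := fun e => D2 e + C e)) => //.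
  - move=> e; have := CD1 e; rewrite /D1 /D2; case: (comp_edge e) => /=.
      case: (eqVneq (col e) k) => //= ->; rewrite eq_sym jk.
      by case: (C e) => // /(_ isT).
    by case: (C e) => // /(_ isT).
  - by move=> u; rewrite /bd2 bdD -!/(bd2 ep _ u) ev2 evC.
  - rewrite (eq_bigr (fun e => D2 e * N e + C e * N e)); last by move=> e _; rewrite mulrDl.
    by rewrite big_split /= odd2 oddC.
rewrite negb_exists => /forallP bal; have [X hX] := potential ep N D1.
(* Since [D1] is balanced, switching at [X] makes all its edges positive. *)
pose tau' e b := sgb (X (ep e b)) * tau e b.
pose N' e := N e + (X (ep e false) + X (ep e true)).
have tauP' e b : tau' e b = 1 \/ tau' e b = -1.
  by rewrite /tau' /sgb; case: (X _); case: (tauP e b) => ->; auto.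
have tauN' e b : tau' e b * tau' e (~~ b) = - sgb (N' e).
  rewrite /tau' mulrACA tauN /N' (cut_half ep X e b) /sgb.
  by case: (X _); case: (X _); case: (N e).
have [|||f [suppf flowf le9 nzf]] := balanced_factor_flow tauP' tauN' ij ik jk.
- move=> e Ae; rewrite /N' (hX e Ae (bal _)).
  by case: (X _); case: (X _).
(* [D2] stays odd under switching and its edges of colour [i] are now positive, so colour [k] is
   odd. *)
- have oddN' : \sum_e D2 e * N' e = 1.
    rewrite (eq_bigr (fun e => D2 e * N e + D2 e * (X (ep e false) + X (ep e true)))).
      by rewrite big_split /= odd2 (even_cut X ev2).
    by move=> e _; rewrite mulrDr.
  rewrite -[RHS]oddN'; apply: eq_bigr => e _; rewrite /matching /D2.
  case: (boolP (comp_edge e)) => Ke //=.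
  case: (eqVneq (col e) k) => [->|ck]; first by rewrite eq_sym jk.
  rewrite mul0r {1}/N' (hX e _ (bal _)) ?/D1 ?Ke //.
  by case: (X _); case: (X _); case: (col e == j).
- move=> [e1 [Y [Ke1 hY]]]; apply: (no_single_negative flow0 nz).
  exists e1, (fun v => X v + Y v); split=> // e Ke; rewrite -hY // /N'.
  by case: (N e); case: (X _); case: (X _); case: (Y _); case: (Y _).
(* Switching only changes the boundary at each vertex by a sign, so [f] is also a flow for [tau]. *)
exists f; split=> // v; have := flowf v; rewrite bd_switch => /eqP.
by rewrite mulf_eq0 => /orP [|/eqP //]; rewrite /sgb; case: (X v).
Qed.

End ComponentFlow.

(** * Assembling the flow on the whole graph *)

Lemma colour_half_edges (G : multigraph) (c : edge G -> 'I_3) :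
  cubic G -> proper_edge_coloring c ->
  exists half : vertex G -> 'I_3 -> edge G * bool,
    [/\ forall v i, endpoint (half v i).1 (half v i).2 = v,
        forall v i, c (half v i).1 = i &
        forall h : edge G * bool, half (endpoint h.1 h.2) (c h.1) = h].
Proof.
move=> hcubic hc.
have inj v : {in half_edges_at v &, injective (fun h : edge G * bool => c h.1)}.
  move=> h h' hv hv' hh'; apply/eqP; apply/negPn/negP => /eqP neq.
  exact: hc hv hv' neq hh'.
have /fin_all_exists [half halfP] (p : vertex G * 'I_3) :
    exists h : edge G * bool, endpoint h.1 h.2 = p.1 /\ c h.1 = p.2.
  (* The colouring is injective on the three half edges at a vertex, so all three colours occur. *)
  have full : [set c h.1 | h : edge G * bool in half_edges_at p.1] = setT.
    apply/eqP; rewrite eqEcard subsetT cardsT card_ord card_in_imset; last exact: inj.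
    by have := hcubic p.1; rewrite /degree => ->.
  have : p.2 \in [set: 'I_3] by rewrite inE.
  by rewrite -full => /imsetP [h]; rewrite inE => /eqP hv hc'; exists h.
exists (fun v i => half (v, i)); split=> [v i|v i|h]; try by case: (halfP (v, i)).
have [/= h1 h2] := halfP (endpoint h.1 h.2, c h.1).
by apply: (inj (endpoint h.1 h.2)); rewrite // inE ?h1.
Qed.

Local Close Scope ring_scope.

Theorem theorem1p1 (G : multigraph) (sigma : edge G -> int)
    (hsigma : signature sigma) (hcubic : cubic G) (hcol : edge_colorable G 3)
    (hadm : flow_admissible sigma) :
  has_nowhere_zero_flow sigma 10.
Proof.
case: hcol => c /(colour_half_edges hcubic) [half [half_end half_col halfK]].
case: hadm => k [_ [tau [f0 [[[tauP tau_sigma] _ flow0] nz0]]]].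
pose ep := @endpoint G; pose t e b := tau (e, b); pose N e := sigma e == (- 1)%R.
have tP e b : t e b = 1%R \/ t e b = (- 1)%R by exact: tauP.
have tN e b : (t e b * t e (~~ b) = - sgb (N e))%R.
  have -> : (t e b * t e (~~ b) = - sigma e)%R.
    by rewrite -tau_sigma /t; case: b; rewrite // mulrC.
  by rewrite /N; case: (hsigma e) => ->.
have bdE z v : bd ep t z v = (\sum_(h in half_edges_at v) tau h * z (edge_of h))%R.
  by rewrite bd_halves; apply: eq_big => [h|[e b] _]; rewrite ?inE.
have f0_flow v : bd ep t f0 v = 0%R by rewrite bdE flow0.
have f0_nz e : f0 e != 0%R by apply/eqP/nz0.
have /fin_all_exists [F FP] r :=
  component_flow half_end half_col halfK r tP tN f0_flow f0_nz.
pose rt v := fingraph.root (adj ep (fun=> true)) v.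
have comp_rt e : comp_edge ep (rt (ep e false)) e.
  by rewrite /comp_edge /in_comp adj_sym; exact: connect_root.
(* Each edge takes its value from the flow chosen for the root of its own component. *)
exists tau, (fun e => F (rt (ep e false)) e); split; last first.
  by move=> e; case: (FP (rt (ep e false))) => _ _ _ nz; apply/eqP/nz.
split=> [|e|v]; first by split.
  by case: (FP (rt (ep e false))) => _ _ le9 _; exact: le9.
(* All edges at [v] share the root of [v], so a single component flow enters the sum. *)
case: (FP (rt v)) => _ flow _ _; rewrite -[RHS](flow v) bdE.
apply: eq_bigr => -[e b]; rewrite inE => /eqP /= hv; congr (_ * F _ _)%R.
apply/(fingraph.rootP (adj_sym ep _)); rewrite -hv; case: (b); last exact: connect0.
exact/connect1/adj_edge.
Qed.
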